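(* The projective quasi-Heisenberg algebra $\mathfrak{q}_{\mathrm{proj}}$ (a $\mathbb{Z}$-algebra) is generated by the set $\{e_n,\ {}^R\mathbf{h}_n^*\mid n\in\mathbb{N}\}$, and a complete set of relations is $$[e_n,e_k]=0,\qquad[{}^R\mathbf{h}_n^*,e_k]=e_{k-1}\,{}^R\mathbf{h}_{n-1}^*,\qquad n,k\in\mathbb{N},$$ with the conventions $e_0={}^R\mathbf{h}_0^*=1$ and $e_n={}^R\mathbf{h}_n^*=0$ for $n<0$.
   Context: $\mathrm{QSym}$ is the algebra of quasisymmetric functions over $\mathbb{Z}$ in $x_1,x_2,\dots$, with basis the monomial quasisymmetric functions $M_\alpha=\sum_{i_1<\dots<i_r}x_{i_1}^{\alpha_1}\cdots x_{i_r}^{\alpha_r}$ for compositions $\alpha=(\alpha_1,\dots,\alpha_r)$ ($M_\varnothing=1$) and coproduct $\Delta(M_\alpha)=\sum_{\alpha=\beta\cdot\gamma}M_\beta\otimes M_\gamma$ ($\beta\cdot\gamma$ is concatenation). $\mathrm{Sym}\subseteq\mathrm{QSym}$ is the ring of symmetric functions, $e_n$ the elementary symmetric functions. $\mathrm{NSym}$ is the free associative $\mathbb{Z}$-algebra on $\mathbf{h}_1,\mathbf{h}_2,\dots$ with coproduct $\Delta(\mathbf{h}_n)=\sum_{i=0}^n\mathbf{h}_i\otimes\mathbf{h}_{n-i}$ ($\mathbf{h}_0=1$), and basis $\mathbf{h}_\alpha=\mathbf{h}_{\alpha_1}\cdots\mathbf{h}_{\alpha_r}$. The pairing $\langle\cdot,\cdot\rangle\colon\mathrm{NSym}\times\mathrm{QSym}\to\mathbb{Z}$,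 $\langle\mathbf{h}_\alpha,M_\beta\rangle=\delta_{\alpha\beta}$, is a Hopf pairing making these graded dual Hopf algebras. For $x\in\mathrm{NSym}$, ${}^Rx^*\in\mathrm{End}(\mathrm{QSym})$ is defined by $\langle y,{}^Rx^*(a)\rangle=\langle yx,a\rangle$. The quasi-Heisenberg algebra $\mathfrak{q}=\mathfrak{h}(\mathrm{QSym},\mathrm{NSym})$ is $\mathrm{QSym}\otimes\mathrm{NSym}$ with $a\otimes x$ written $a\# x$ and product $(a\# x)(b\# y)=\sum_{(x)}a\,{}^Rx_{(1)}^*(b)\# x_{(2)}y$; it acts faithfully on $\mathrm{QSym}$ by $(a\# x)(b)=a\,{}^Rx^*(b)$. An element $a\in\mathrm{QSym}$ is identified with $a\#1\in\mathfrak{q}$, and ${}^R\mathbf{h}_n^*$ denotes the element $1\#\mathbf{h}_n\in\mathfrak{q}$. $\mathfrak{q}_{\mathrm{proj}}$ is the subalgebra of $\mathfrak{q}$ generated by $\mathrm{NSym}$ and $\mathrm{Sym}\subseteq\mathrm{QSym}$. *)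

(* Defs.v *)
From HB Require Import structures.
From mathcomp Require Import all_boot all_order all_algebra.
From mathcomp Require Import finmap boolp.
From mathcomp Require Import monalg.
From mathcomp Require Import zify.

Set Implicit Arguments.
Unset Strict Implicit.
Unset Printing Implicit Defensive.

Import Order.TTheory GRing.Theory Num.Theory.

Local Open Scope fset_scope.
Local Open Scope ring_scope.

(* Conventions.
   - The variables [x_1, x_2, ...] are indexed by [nat], so [x_{i+1}] is the
     variable of index [i].
   - Parts of compositions are positive; in [composition := {fmonom nat}] the
     letter [k] stands for the part [k+1], so that every word over [nat] is a
     composition, and the monomial product is concatenation.
   - [NSym], the free Z-algebra on [h_1, h_2, ...], is the monoid algebra
     [{malg int[composition]}]; its basis element [<< alpha >>] is [h_alpha].
   - As [NSym] is free over Z on the [h_alpha], [A (x) NSym] is rendered as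
     [{malg A[composition]}], where [<< a *g alpha >>] is [a (x) h_alpha].
     For [A = NSym] the library's product on [{malg NSym[composition]}] is the
     product of the tensor product algebra. *)

Lemma mcoeff_sumU (K : choiceType) (G : zmodType) (D : {fset K}) (F : K -> G) d :
  (\sum_(k <- D) << F k *g k >>)@_d = if d \in D then F d else 0.
Proof.
rewrite raddf_sum /=; case: ifPn => dD; last first.
  rewrite big1_fset // => k kD _; rewrite mcoeffU.
  by case: eqP kD dD => // -> ->.
rewrite (big_fsetD1 d) //= mcoeffU eqxx big1_fset ?addr0 // => k.
by rewrite in_fsetD1 mcoeffU => /andP[/negPf->].
Qed.

Notation mon := {cmonom nat}.

HB.lock Definition mdivisors (m : mon) : {fset mon} :=
  [fset d in [seq [cmonom nat_of_ord (k i) | i : finsupp m]%M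
             | k : {dffun forall i : finsupp m, 'I_(m (val i)).+1}]].

Lemma mdivisorsP (m d : mon) :
  reflect (forall i, d i <= m i)%N (d \in mdivisors m).
Proof.
rewrite mdivisors.unlock in_fset /=; apply: (iffP imageP) => [[k _ ->] i|le_dm].
  by rewrite cmE fsfun_ffun; case: insubP => // u _ <-; rewrite -ltnS ltn_ord.
have lt (i : finsupp m) : (d (val i) < (m (val i)).+1)%N by rewrite ltnS.
exists [ffun i => Ordinal (lt i)] => //.
apply/eqP/cmP => i; rewrite cmE fsfun_ffun; case: insubP => [u _ <-|im].
  by rewrite /= ffunE.
by apply/eqP; rewrite -leqn0 (leq_trans (le_dm i)) // leqn0 cmE_eq0.
Qed.

(* Formal power series in countably many variables, given by coefficients *)
Definition fps : Type := mon -> int.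
HB.instance Definition _ := gen_eqMixin fps.
HB.instance Definition _ := gen_choiceMixin fps.

Definition fps_zero : fps := fun=> 0.
Definition fps_opp (f : fps) : fps := fun m => - f m.
Definition fps_add (f g : fps) : fps := fun m => f m + g m.
Definition fps_one : fps := fun m => (m == mone)%:R.
Definition fps_mul (f g : fps) : fps :=
  fun m => \sum_(d <- mdivisors m) f d * g (divcm m d).

Lemma fps_addA : associative fps_add.
Proof. by move=> f g h; apply/funext => m; rewrite /fps_add addrA. Qed.
Lemma fps_addC : commutative fps_add.
Proof. by move=> f g; apply/funext => m; rewrite /fps_add addrC. Qed.
Lemma fps_add0 : left_id fps_zero fps_add.
Proof. by move=> f; apply/funext => m; rewrite /fps_add add0r. Qed.
Lemma fps_addN : left_inverse fps_zero fps_opp fps_add.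
Proof. by move=> f; apply/funext => m; rewrite /fps_add addNr. Qed.
HB.instance Definition _ :=
  GRing.isZmodule.Build fps fps_addA fps_addC fps_add0 fps_addN.

(* The ring axioms for [fps] are inherited from those of [{malg int[mon]}] by
   comparing series and polynomials on the divisors of a monomial. *)
Definition agree (m : mon) (f : fps) (p : {malg int[mon]}) :=
  forall d, d \in mdivisors m -> p@_d = f d.

Lemma agreeE m f g p q : agree m f p -> agree m g q ->
  fps_mul f g m = (p * q)@_m.
Proof.
rewrite /agree /fps_mul; have := mdivisorsP m.
move: (mdivisors m) => D DP fp gq.
rewrite (mcoeffMlw _ (fsubsetUl (msupp p) D) (fsubsetUl (msupp q) D)).
rewrite [RHS](big_fsetID _ (mem D)) /= [X in _ + X]big1_fset ?addr0; last first.
  move=> k1; rewrite !inE /= => /andP[_ k1D] _.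
  apply: big1 => k2 _; case: eqP => // mE; case/negP: k1D.
  by apply/DP => i; rewrite -mE cmM leq_addr.
have -> : [fset x in msupp p `|` D | x \in D] = D.
  by apply/fsetP => x; rewrite !inE andb_orl andbb; case: (x \in D); rewrite ?orbT ?andbF.
apply: eq_big_seq => d dD; have /DP dm := dD.
have mE : mmul d (divcm m d) = m.
  by apply/eqP/cmP => i; rewrite cmM divcmE subnKC.
have d'D : divcm m d \in D.
  by apply/DP => i; rewrite divcmE leq_subr.
rewrite (big_fsetD1 (divcm m d)) /=; last by rewrite inE d'D orbT.
rewrite mE eqxx fp // gq // big1_fset ?addr0 // => k2.
rewrite in_fsetD1 => /andP[/eqP k2d _] _; case: eqP => // mE2; case: k2d.
by apply/eqP/cmP => i; rewrite divcmE -mE2 cmM addKn.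
Qed.

Definition trunc (m : mon) (f : fps) : {malg int[mon]} :=
  \sum_(d <- mdivisors m) << f d *g d >>.

Lemma agree_trunc m f : agree m f (trunc m f).
Proof. by move=> d dm; rewrite mcoeff_sumU dm. Qed.

Lemma agree_sub m d f p : d \in mdivisors m -> agree m f p -> agree d f p.
Proof.
move=> /mdivisorsP dm fp k /mdivisorsP kd; apply: fp.
by apply/mdivisorsP => i; rewrite (leq_trans (kd i)).
Qed.

Lemma agree_mul m f g p q : agree m f p -> agree m g q ->
  agree m (fps_mul f g) (p * q).
Proof.
by move=> fp gq d dm; rewrite -(agreeE (f := f) (g := g)) //; apply: agree_sub dm _.
Qed.

Lemma agree_one m : agree m fps_one 1.
Proof. by move=> d _; rewrite mcoeff1. Qed.

Lemma agree_add m f g p q : agree m f p -> agree m g q -> agree m (f + g) (p + q).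
Proof. by move=> fp gq d dm; rewrite mcoeffD fp ?gq. Qed.

Lemma mdivisors_id m : m \in mdivisors m.
Proof. by apply/mdivisorsP. Qed.

Lemma fps_mulA : associative fps_mul.
Proof.
move=> f g h; apply/funext => m.
have [[tf tg] th] := (@agree_trunc m f, @agree_trunc m g, @agree_trunc m h).
by rewrite (agreeE tf (agree_mul tg th)) mulrA (agreeE (agree_mul tf tg) th).
Qed.

Lemma fps_mulC : commutative fps_mul.
Proof.
move=> f g; apply/funext => m.
have [tf tg] := (@agree_trunc m f, @agree_trunc m g).
by rewrite (agreeE tf tg) (agreeE tg tf); apply: (congr1 (mcoeff m)); exact: mulrC.
Qed.

Lemma fps_mul1 : left_id fps_one fps_mul.
Proof.
move=> f; apply/funext => m.
have tf := @agree_trunc m f.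
by rewrite (agreeE (@agree_one m) tf) mul1r tf ?mdivisors_id.
Qed.

Lemma fps_mulDl : left_distributive fps_mul fps_add.
Proof.
move=> f g h; apply/funext => m.
have [[tf tg] th] := (@agree_trunc m f, @agree_trunc m g, @agree_trunc m h).
rewrite (agreeE (agree_add tf tg) th) mulrDl mcoeffD /fps_add.
by rewrite (agreeE tf th) (agreeE tg th).
Qed.

Lemma fps_oner_neq0 : fps_one != 0.
Proof.
apply/eqP => /(congr1 (fun f : fps => f mone)) /eqP.
by rewrite /fps_one eqxx.
Qed.

HB.instance Definition _ := GRing.Zmodule_isComNzRing.Build fps
  fps_mulA fps_mulC fps_mul1 fps_mulDl fps_oner_neq0.

Notation composition := {fmonom nat}.

(* If [m = x_{i_1}^{a_1} ... x_{i_r}^{a_r}] with [i_1 < ... < i_r] and all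
   [a_j > 0], then [expseq m] is the composition [(a_1, ..., a_r)]. *)
HB.lock Definition expseq (m : mon) : composition :=
  FMonom [seq (m i).-1 | i <- sort leq (finsupp m)].

Definition xpow (i a : nat) : mon := [cmonom a | _ in fset1 i]%M.

Lemma xpowE i a j : xpow i a j = if j == i then a else 0%N.
Proof. by rewrite cmE fsfun_fun in_fset1. Qed.

(* The composition [(n)], or the empty one if [n = 0] *)
Definition hword (n : nat) : seq nat := if n is k.+1 then [:: k] else [::].

Lemma finsupp_xpowM i a (m : mon) :
  finsupp (mmul (xpow i a.+1) m) = i |` finsupp m.
Proof.
apply/fsetP => j; rewrite in_fset1U -!cmE_neq0 cmM xpowE.
by case: (j =P i).
Qed.

Lemma expseq_xpowM i a (m : mon) : (forall j, m j != 0%N -> (i < j)%N) ->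
  expseq (mmul (xpow i a) m) = hword a ++ expseq m :> seq nat.
Proof.
move=> lt_im; case: a => [|a].
  congr (fmonom_val (expseq _)); apply/eqP/cmP => j.
  by rewrite cmM xpowE; case: ifP.
rewrite expseq.unlock /=.
have mi0 : m i = 0%N by apply/eqP; apply: contraT => /lt_im; rewrite ltnn.
have -> : sort leq (finsupp (mmul (xpow i a.+1) m)) = i :: sort leq (finsupp m).
  apply: (sorted_eq leq_trans anti_leq); first exact: (sort_sorted leq_total).
  - rewrite /= path_min_sorted; first exact: (sort_sorted leq_total).
    apply/allP => j; rewrite mem_sort -cmE_neq0 => /lt_im; exact: ltnW.
  - rewrite finsupp_xpowM perm_sort.
    have iNm : i \notin finsupp m by rewrite -cmE_eq0 mi0.
    apply: uniq_perm; rewrite ?fset_uniq //= ?sort_uniq ?fset_uniq ?mem_sort ?iNm //.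
    by move=> j; rewrite in_fset1U inE mem_sort.
have Ei : mmul (xpow i a.+1) m i = a.+1 by rewrite cmM xpowE eqxx mi0 addn0.
rewrite /= Ei /=; congr (_ :: _).
apply/eq_in_map => j; rewrite mem_sort -cmE_neq0 => /lt_im ltij.
by rewrite cmM xpowE gtn_eqF.
Qed.

Lemma expseq1 : expseq mone = [::] :> seq nat.
Proof. by apply: size0nil; rewrite expseq.unlock size_map size_sort mdom1 cardfs0. Qed.

Lemma mon_ind (P : mon -> Prop) : P mone ->
  (forall (i a : nat) (m : mon), (forall j, m j != 0%N -> (i < j)%N) -> P m ->
     P (mmul (xpow i a.+1) m)) ->
  forall m, P m.
Proof.
move=> P1 PM m; move: {2}#|`finsupp m| (leqnn #|`finsupp m|) => n.
elim: n m => [|n IHn] m le_mn.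
  suff -> : m = mone by [].
  apply/eqP/cmP => i; rewrite cm1; apply/eqP; rewrite cmE_eq0.
  by move: le_mn; rewrite leqn0 cardfs_eq0 => /eqP->; rewrite in_fset0.
have [->//|m1] := eqVneq m mone.
have ex : exists i, m i != 0%N.
  apply: contrapT => nex; case/cmP: m1 => i; rewrite cm1; apply/eqP.
  by apply: contraT => mi; case: nex; exists i.
case: (ex_minnP ex) => i mi min_i.
pose m' : mon := divcm m (xpow i (m i)).
have m'E j : m' j = if j == i then 0%N else m j.
  by rewrite divcmE xpowE; case: eqP => [->|_]; rewrite ?subnn ?subn0.
have mE : mmul (xpow i (m i).-1.+1) m' = m.
  apply/eqP/cmP => j; rewrite cmM m'E xpowE; case: eqP => [->|//].
  by rewrite addn0 prednK // lt0n.
rewrite -mE; apply: PM => [j|].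
  by rewrite m'E; case: (eqVneq j i) => // nij mj; rewrite ltn_neqAle eq_sym nij min_i.
apply: IHn; move: le_mn; rewrite -{1}mE finsupp_xpowM cardfsU1.
by rewrite -cmE_eq0 m'E eqxx eqxx /= add1n ltnS.
Qed.

Lemma mdivisors1 : mdivisors mone = [fset mone].
Proof.
apply/fsetP => d; rewrite in_fset1; apply/mdivisorsP/eqP => [h|-> //].
by apply/eqP/cmP => i; apply/eqP; move: (h i); rewrite cm1 leqn0.
Qed.

Lemma mdivisors_xpowM i a (m : mon) : m i = 0%N ->
  perm_eq (mdivisors (mmul (xpow i a) m))
    [seq mmul (xpow i c) d | c <- iota 0 a.+1, d <- mdivisors m].
Proof.
move=> mi0.
have us := iota_uniq 0 a.+1.
have ms c : (c \in iota 0 a.+1) = (c <= a)%N by rewrite mem_iota add0n ltnS.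
move: (iota 0 a.+1) us ms => s us ms.
have di0 d : d \in mdivisors m -> d i = 0%N.
  by move=> /mdivisorsP/(_ i); rewrite mi0 leqn0 => /eqP.
apply: uniq_perm; first exact: fset_uniq.
  apply: allpairs_uniq => //; first exact: fset_uniq.
  move=> [c d] [c' d'] /allpairsP[[? ?] /= [_ dm [-> ->]]].
  move=> /allpairsP[[? ?] /= [_ dm' [-> ->]]] E.
  have /eqP/cmP {}E := E.
  move: (E i); rewrite !cmM !xpowE eqxx !di0 // !addn0 => ->.
  congr (_, _); apply/eqP/cmP => j; move: (E j); rewrite !cmM !xpowE.
  by case: eqP => [->|_]; rewrite ?di0 // !add0n.
move=> d; apply/mdivisorsP/allpairsP => [le|[[c d'] /= [ca /mdivisorsP le ->]]].
  exists (d i, divcm d (xpow i (d i))); split=> /=.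
  - by rewrite ms; move: (le i); rewrite cmM xpowE eqxx mi0 addn0.
  - apply/mdivisorsP => j; rewrite divcmE xpowE; case: eqP => [->|/eqP/negPf nij].
      by rewrite subnn.
    by rewrite subn0; move: (le j); rewrite cmM xpowE nij.
  - apply/eqP/cmP => j; rewrite cmM divcmE xpowE; case: eqP => [->|_].
      by rewrite subnn addn0.
    by rewrite subn0.
move=> j; rewrite !cmM !xpowE leq_add //; case: ifP => // _.
by rewrite -ms.
Qed.

(* The sum of [phi b * psi c] over the ways to split every part [a_i] of a
   composition as [a_i = b_i + c_i], parts equal to [0] being dropped. *)
Fixpoint ssplit (phi psi : seq nat -> int) (s : seq nat) : int :=
  if s is k :: s' then
    \sum_(0 <= c < k.+2) ssplit (fun w => phi (hword c ++ w))
                               (fun w => psi (hword (k.+1 - c) ++ w)) s'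
  else phi [::] * psi [::].

Lemma ssplit_cons phi psi k s : ssplit phi psi (k :: s) =
  \sum_(c <- iota 0 k.+2) ssplit (fun w => phi (hword c ++ w))
                               (fun w => psi (hword (k.+1 - c) ++ w)) s.
Proof. by []. Qed.

Lemma fps_mul_split phi psi m :
  \sum_(d <- mdivisors m) phi (expseq d : seq nat) * psi (expseq (divcm m d) : seq nat)
    = ssplit phi psi (expseq m).
Proof.
elim/mon_ind: m phi psi => [|i a m lt_im IHm] phi psi.
  rewrite mdivisors1 big_seq_fset1 expseq1 /=.
  have -> : divcm mone mone = mone :> mon.
    by apply/eqP/cmP => i; rewrite divcmE subnn cm1.
  by rewrite expseq1.
have mi0 : m i = 0%N by apply/eqP; apply: contraT => /lt_im; rewrite ltnn.
rewrite (perm_big _ (mdivisors_xpowM _ mi0)) big_allpairs_dep.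
rewrite (expseq_xpowM _ lt_im) [hword _ ++ _]cat1s ssplit_cons.
apply: eq_bigr => c _; rewrite -IHm.
apply: eq_big_seq => d /mdivisorsP dm.
rewrite expseq_xpowM; last first.
  by move=> j dj; apply: lt_im; move: (dm j) dj; rewrite -!lt0n => /[swap]; apply: leq_trans.
have -> : divcm (mmul (xpow i a.+1) m) (mmul (xpow i c) d) =
          mmul (xpow i (a.+1 - c)) (divcm m d).
  apply/eqP/cmP => j; rewrite divcmE !cmM divcmE !xpowE.
  case: eqP => [->|_]; last by rewrite !add0n.
  by have := dm i; rewrite mi0 leqn0 => /eqP ->; rewrite !addn0.
rewrite expseq_xpowM // => j; rewrite divcmE => mj; apply: lt_im.
by apply: contraNneq mj => ->.
Qed.

(* [x_{i_1}^{a_1} ... x_{i_r}^{a_r}] and [x_{j_1}^{a_1} ... x_{j_r}^{a_r}] have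
   the same coefficient whenever [i_1 < ... < i_r] and [j_1 < ... < j_r]. *)
Definition quasisymmetric (f : fps) : Prop :=
  forall m m' : mon, expseq m = expseq m' -> f m = f m'.

Definition bounded_degree (f : fps) : Prop :=
  exists n : nat, forall m : mon, (n < mdeg m)%N -> f m = 0.

Definition qsymmetric : {pred fps} :=
  fun f => `[< quasisymmetric f /\ bounded_degree f >].

Lemma qsymmetricP f :
  reflect (quasisymmetric f /\ bounded_degree f) (f \in qsymmetric).
Proof. exact: asboolP. Qed.

(* [x_1^{a_1} ... x_r^{a_r}], where [w] encodes [(a_1, ..., a_r)]; its coefficient
   in a quasisymmetric function [f] is the coefficient of [M_w] in [f]. *)
Definition compmon (w : seq nat) : mon :=
  [cmonom (nth 0%N (map S w) i) | i in seq_fset tt (iota 0 (size w))]%M.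

Lemma compmonE w i : compmon w i = nth 0%N (map S w) i.
Proof.
rewrite cmE fsfun_fun seq_fsetE mem_iota /= add0n; case: ltnP => // le.
by rewrite nth_default // size_map.
Qed.

Lemma expseq_compmon w : expseq (compmon w) = w :> seq nat.
Proof.
have fsE : sort leq (finsupp (compmon w)) = iota 0 (size w).
  apply: (sorted_eq leq_trans anti_leq); first exact: (sort_sorted leq_total).
    exact: iota_sorted.
  rewrite perm_sort; apply: uniq_perm; rewrite ?fset_uniq ?iota_uniq // => i.
  rewrite -cmE_neq0 compmonE mem_iota /= add0n.
  case: (ltnP i (size w)) => le; first by rewrite (nth_map 0%N).
  by rewrite nth_default // size_map.
rewrite expseq.unlock /= fsE; apply: (@eq_from_nth _ 0%N); rewrite size_map size_iota //.
by move=> i lt; rewrite (nth_map 0%N) ?size_iota // nth_iota // compmonE (nth_map 0%N).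
Qed.

Lemma expseq_eq (m m' : mon) : expseq m = expseq m' :> seq nat -> expseq m = expseq m'.
Proof. by move=> E; apply: val_inj. Qed.

Lemma qsym_compmon f m : f \in qsymmetric -> f (compmon (expseq m)) = f m.
Proof.
by move=> /qsymmetricP[fq _]; apply: fq; apply: expseq_eq; rewrite expseq_compmon.
Qed.

Lemma fps0E m : (0 : fps) m = 0. Proof. by []. Qed.
Lemma fps1E m : (1 : fps) m = (m == mone)%:R. Proof. by []. Qed.
Lemma fpsDE (f g : fps) m : (f + g) m = f m + g m. Proof. by []. Qed.
Lemma fpsNE (f : fps) m : (- f) m = - f m. Proof. by []. Qed.
Lemma fpsME (f g : fps) m :
  (f * g) m = \sum_(d <- mdivisors m) f d * g (divcm m d).
Proof. by []. Qed.

Lemma qsym_mulE f g m : f \in qsymmetric -> g \in qsymmetric ->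
  (f * g) m = ssplit (fun w => f (compmon w)) (fun w => g (compmon w)) (expseq m).
Proof.
move=> fq gq; rewrite -fps_mul_split fpsME; apply: eq_bigr => d _.
by rewrite !qsym_compmon.
Qed.

Lemma mdeg_divcm (m d : mon) : d \in mdivisors m ->
  mdeg m = (mdeg d + mdeg (divcm m d))%N.
Proof.
move=> /mdivisorsP dm; rewrite -mdegM; congr mdeg.
by apply/eqP/cmP => i; rewrite cmM divcmE subnKC.
Qed.

Lemma expseq_eq1 (k : mon) : (k == mone) = (expseq k == mone).
Proof.
apply/eqP/eqP => [->|]; first by apply: val_inj; rewrite /= expseq1 fm1.
move/(congr1 (fun w : composition => size w)); rewrite expseq.unlock size_map size_sort fm1 /= => k0.
apply/eqP/cmP => i; apply/eqP; rewrite cm1 cmE_eq0.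
by move/eqP: k0; rewrite cardfs_eq0 => /eqP->; rewrite in_fset0.
Qed.

Fact qsymmetric_subring : subring_closed qsymmetric.
Proof.
split=> [|f g fq gq|f g fq gq]; apply/qsymmetricP.
- split=> [m m' E|]; first by rewrite !fps1E !expseq_eq1 E.
  by exists 0%N => m; rewrite lt0n mdeg_eq0 fps1E => /negPf ->.
- have /qsymmetricP[qf [n fn]] := fq; have /qsymmetricP[qg [n' gn]] := gq.
  split=> [m m' E|]; first by rewrite !fpsDE !fpsNE (qf _ _ E) (qg _ _ E).
  exists (maxn n n') => m; rewrite gtn_max => /andP[mn mn'].
  by rewrite fpsDE fpsNE fn // gn // subr0.
- split=> [m m' E|]; first by rewrite !qsym_mulE // E.
  have /qsymmetricP[qf [n fn]] := fq; have /qsymmetricP[qg [n' gn]] := gq.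
  exists (n + n')%N => m ltm; rewrite fpsME big_seq big1 // => d dm.
  have [lt|le] := ltnP n (mdeg d); first by rewrite fn // mul0r.
  rewrite [X in _ * X]gn ?mulr0 //.
  by move: ltm; rewrite (mdeg_divcm dm); move: le; lia.
Qed.
HB.instance Definition _ :=
  GRing.isSubringClosed.Build fps qsymmetric qsymmetric_subring.

Record QSym : Type := MkQSym { qsfun : fps; _ : qsfun \in qsymmetric }.
HB.instance Definition _ := [isSub of QSym for qsfun].
HB.instance Definition _ := [Choice of QSym by <:].
HB.instance Definition _ := [SubChoice_isSubComNzRing of QSym by <:].

Section LinearExtension.
Variables (K : choiceType) (G V : zmodType).
Implicit Types (F : K -> G -> V) (f : {malg G[K]} -> V) (g : {malg G[K]}).

Lemma mlin0 F k : (forall x y, F k (x - y) = F k x - F k y) -> F k 0 = 0.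
Proof. by move=> FB; rewrite -(subrr 0) FB subrr. Qed.

Lemma mlinEw F (D : {fset K}) g :
  (forall k x y, F k (x - y) = F k x - F k y) -> msupp g `<=` D ->
  \sum_(k <- msupp g) F k g@_k = \sum_(k <- D) F k g@_k.
Proof.
move=> FB le; rewrite [LHS](big_fset_incl _ le) => //= x xd /mcoeff_outdom ->.
exact: mlin0.
Qed.

Lemma mlinU F k c : (forall k x y, F k (x - y) = F k x - F k y) ->
  \sum_(j <- msupp << c *g k >>) F j << c *g k >>@_j = F k c.
Proof.
by move=> FB; rewrite (mlinEw FB (msuppU_le (k := k))) big_seq_fset1 mcoeffUU.
Qed.

Lemma mlinB F : (forall k x y, F k (x - y) = F k x - F k y) ->
  forall g h, \sum_(k <- msupp (g - h)) F k (g - h)@_k =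
   \sum_(k <- msupp g) F k g@_k - \sum_(k <- msupp h) F k h@_k.
Proof.
move=> FB g h; pose D := msupp g `|` msupp h.
rewrite (mlinEw FB (msuppB_le g h)) -/D.
rewrite (mlinEw FB (fsubsetUl _ _ : msupp g `<=` D)).
rewrite (mlinEw FB (fsubsetUr _ _ : msupp h `<=` D)) -sumrB.
by apply: eq_bigr => k _; rewrite mcoeffB FB.
Qed.

Lemma mlin_ext f1 f2 : (forall g h, f1 (g - h) = f1 g - f1 h) ->
  (forall g h, f2 (g - h) = f2 g - f2 h) ->
  (forall c k, f1 << c *g k >> = f2 << c *g k >>) -> forall g, f1 g = f2 g.
Proof.
move=> B1 B2 E g.
have Z f : (forall g h, f (g - h) = f g - f h) -> f 0 = 0.
  by move=> B; have := B 0 0; rewrite !subrr.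
have D f : (forall g h, f (g - h) = f g - f h) -> {morph f : g h / g + h}.
  by move=> B x y; rewrite -[in LHS](opprK y) B; have := B 0 y; rewrite Z // !sub0r => ->; rewrite opprK.
rewrite (monalgE g); apply: (big_ind (fun g => f1 g = f2 g)) => [|x y Ex Ey|k _].
- by rewrite !Z.
- by rewrite !D // Ex Ey.
- exact: E.
Qed.
End LinearExtension.

Lemma malgMUU (R : nzRingType) (K : monomType) (c d : R) (k l : K) :
  << c *g k >> * << d *g l >> = << c * d *g mmul k l >> :> {malg R[K]}.
Proof. exact: fgmulUU. Qed.

Lemma malgMBl (R : nzRingType) (K : monomType) (x y z : {malg R[K]}) :
  (x - y) * z = x * z - y * z.
Proof. exact: mulrBl. Qed.
Lemma malgMBr (R : nzRingType) (K : monomType) (x y z : {malg R[K]}) :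
  z * (x - y) = z * x - z * y.
Proof. exact: mulrBr. Qed.

(* [{malg int[{fmonom X}]}] is the free associative Z-algebra on [X]; [free_eval g]
   is the algebra morphism that extends [g : X -> R]. *)
Section FreeAlgebra.
Context (X : choiceType) (R : nzRingType) (g : X -> R).

Definition free_eval : {malg int[{fmonom X}]} -> R :=
  mmap intr (fun w : {fmonom X} => \prod_(i <- w) g i).

Lemma free_evalB x y : free_eval (x - y) = free_eval x - free_eval y.
Proof. exact: raddfB. Qed.

Lemma free_evalU c w : free_eval << c *g w >> = (\prod_(i <- w) g i) *~ c.
Proof. by rewrite /free_eval mmapU mulrzl. Qed.

Lemma free_evalM x y : free_eval (x * y) = free_eval x * free_eval y.
Proof.
apply: (mlin_ext (f1 := fun x => free_eval (x * y))
                 (f2 := fun x => free_eval x * free_eval y)) => [u v|u v|c k].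
- by rewrite malgMBl free_evalB.
- by rewrite free_evalB mulrBl.
apply: (mlin_ext (f1 := fun y => free_eval (<< c *g k >> * y))
       (f2 := fun y => free_eval << c *g k >> * free_eval y)) => [u v|u v|d l].
- by rewrite malgMBr free_evalB.
- by rewrite free_evalB mulrBr.
by rewrite malgMUU !free_evalU fmM big_cat mulrzAl mulrzAr mulrzA_C.
Qed.

Lemma free_eval1 : free_eval 1 = 1.
Proof. by rewrite (free_evalU 1 mone) fm1 big_nil. Qed.

HB.instance Definition _ :=
  GRing.isZmodMorphism.Build {malg int[{fmonom X}]} R free_eval free_evalB.
HB.instance Definition _ :=
  GRing.isMonoidMorphism.Build {malg int[{fmonom X}]} R free_eval
    (conj free_eval1 free_evalM).

Lemma free_eval_letter i : free_eval << FMonom [:: i] >> = g i.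
Proof. by rewrite free_evalU big_seq1. Qed.
End FreeAlgebra.

Notation NSym := {malg int[composition]}.

(* [h_n], with [h_0 = 1] *)
Definition nh (n : nat) : NSym := << FMonom (hword n) >>.

Definition tensor (A : zmodType) (a : A) (x : NSym) : {malg A[composition]} :=
  \sum_(alpha <- msupp x) << a *~ x@_alpha *g alpha >>.

Definition coproduct_h (n : nat) : {malg NSym[composition]} :=
  \sum_(i < n.+1) tensor (nh i) (nh (n - i)).

Definition coproduct (x : NSym) : {malg NSym[composition]} :=
  free_eval (fun k => coproduct_h k.+1) x.

(* [<h_alpha, a>] is the coefficient of [M_alpha] in [a]; see [pairing_monomial]. *)
Definition pairing (x : NSym) (a : QSym) : int :=
  \sum_(alpha <- msupp x) x@_alpha * qsfun a (compmon alpha).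

Lemma pairingBl (a : QSym) x y : pairing (x - y) a = pairing x a - pairing y a.
Proof.
apply: (@mlinB _ _ _ (fun (al : composition) (c : int) => c * qsfun a (compmon al))) => k c d.
by rewrite mulrBl.
Qed.

Lemma pairingU (a : QSym) c (al : composition) :
  pairing << c *g al >> a = c * qsfun a (compmon al).
Proof.
apply: (@mlinU _ _ _ (fun (al : composition) (c : int) => c * qsfun a (compmon al))) => k x y.
by rewrite mulrBl.
Qed.

Lemma qsfunB (a b : QSym) m : qsfun (a - b) m = qsfun a m - qsfun b m.
Proof. by []. Qed.

Lemma pairingBr x (a b : QSym) : pairing x (a - b) = pairing x a - pairing x b.
Proof.
by rewrite /pairing -sumrB; apply: eq_bigr => k _; rewrite qsfunB mulrBr.
Qed.

Lemma qsfunP (a : QSym) : qsfun a \in qsymmetric.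
Proof. exact: valP. Qed.

Lemma pairing_inj (a b : QSym) : (forall y, pairing y a = pairing y b) -> a = b.
Proof.
move=> E; apply: val_inj; apply/funext => m /=.
rewrite -(qsym_compmon m (qsfunP a)) -(qsym_compmon m (qsfunP b)).
by have := E << expseq m >>; rewrite !pairingU !mul1r.
Qed.

Lemma mdeg_expseq (m : mon) : mdeg m = sumn (map S (expseq m)).
Proof.
elim/mon_ind: m => [|i a m lt_im IHm]; first by rewrite expseq1 mdeg1.
rewrite mdegM IHm (expseq_xpowM _ lt_im) /=.
congr (_ + _)%N; rewrite /mdeg (_ : finsupp _ = [fset i]); last first.
  by apply/fsetP => j; rewrite in_fset1 -cmE_neq0 xpowE; case: (j =P i).
by rewrite big_seq_fset1 xpowE eqxx.
Qed.

Lemma pairingUl (a : QSym) (al : composition) x :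
  pairing (<< al >> * x) a =
  \sum_(be <- msupp x) x@_be * qsfun a (compmon (al ++ be)).
Proof.
pose F (be : composition) (c : int) := c * qsfun a (compmon (al ++ be)).
have FB k c d : F k (c - d) = F k c - F k d by rewrite /F mulrBl.
apply: (mlin_ext (f1 := fun x => pairing (<< al >> * x) a)
                 (f2 := fun x => \sum_(be <- msupp x) F be x@_be)) => [g h|g h|c k].
- by rewrite malgMBr pairingBl.
- exact: mlinB.
- by rewrite (mlinU _ _ FB) malgMUU pairingU mul1r /F fmM.
Qed.

Definition Rstar_fun (x : NSym) (a : QSym) : fps :=
  fun m => pairing (<< expseq m >> * x) a.

Fact Rstar_subproof x a : Rstar_fun x a \in qsymmetric.
Proof.
apply/qsymmetricP; split=> [m m' E|]; first by rewrite /Rstar_fun E.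
have /qsymmetricP[_ [n an]] := qsfunP a.
exists n => m lt_nm; rewrite /Rstar_fun pairingUl big1 // => be _.
rewrite an ?mulr0 // mdeg_expseq expseq_compmon map_cat sumn_cat -mdeg_expseq.
exact: leq_trans lt_nm (leq_addr _ _).
Qed.

(* [^R x^*]: the coefficient of [M_alpha] in [^R x^*(a)] is [<h_alpha x, a>]; the
   defining property [<y, ^R x^*(a)> = <y x, a>] is [Rstar_adjoint]. *)
Definition Rstar (x : NSym) (a : QSym) : QSym := MkQSym (Rstar_subproof x a).

Lemma RstarE x a m : qsfun (Rstar x a) m = pairing (<< expseq m >> * x) a.
Proof. by []. Qed.

Lemma Rstar_adjoint x y a : pairing y (Rstar x a) = pairing (y * x) a.
Proof.
apply: (mlin_ext (f1 := fun y => pairing y (Rstar x a))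
                 (f2 := fun y => pairing (y * x) a)) => [g h|g h|c k].
- exact: pairingBl.
- by rewrite malgMBl pairingBl.
rewrite pairingU RstarE (val_inj (expseq_compmon k) : expseq (compmon k) = k).
apply: (mlin_ext (f1 := fun x => c * pairing (<< k >> * x) a)
                 (f2 := fun x => pairing (<< c *g k >> * x) a)) => [g h|g h|d l].
- by rewrite malgMBr pairingBl mulrBr.
- by rewrite malgMBr pairingBl.
by rewrite !malgMUU !pairingU mul1r mulrA.
Qed.

Lemma RstarBl x y a : Rstar (x - y) a = Rstar x a - Rstar y a.
Proof.
by apply: pairing_inj => z; rewrite pairingBr !Rstar_adjoint malgMBr pairingBl.
Qed.

Lemma RstarBr x a b : Rstar x (a - b) = Rstar x a - Rstar x b.
Proof.
by apply: pairing_inj => z; rewrite pairingBr !Rstar_adjoint pairingBr.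
Qed.

Lemma RstarM x y a : Rstar (x * y) a = Rstar x (Rstar y a).
Proof.
apply: pairing_inj => z; rewrite !Rstar_adjoint.
by apply: (congr1 (pairing^~ a)); exact: mulrA.
Qed.

Lemma Rstar1 a : Rstar 1 a = a.
Proof.
apply: pairing_inj => z; rewrite !Rstar_adjoint.
by apply: (congr1 (pairing^~ a)); exact: mulr1.
Qed.

Lemma tensorBr (A : zmodType) (a : A) x y : tensor a (x - y) = tensor a x - tensor a y.
Proof.
apply: (@mlinB _ _ _ (fun (al : composition) (c : int) => << a *~ c *g al >>)) => k c d.
by rewrite mulrzBr monalgUB.
Qed.

Lemma tensorU (A : zmodType) (a : A) c (al : composition) :
  tensor a << c *g al >> = << a *~ c *g al >>.
Proof.
apply: (@mlinU _ _ _ (fun (al : composition) (c : int) => << a *~ c *g al >>)) => k x y.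
by rewrite mulrzBr monalgUB.
Qed.

Lemma tensorBl (A : zmodType) (a b : A) x : tensor (a - b) x = tensor a x - tensor b x.
Proof.
by rewrite /tensor -sumrB; apply: eq_bigr => k _; rewrite mulrzBl monalgUB.
Qed.

Definition wcop (al : composition) : {malg NSym[composition]} :=
  \prod_(k <- al) coproduct_h k.+1.

Lemma coproductB x y : coproduct (x - y) = coproduct x - coproduct y.
Proof. exact: free_evalB. Qed.

Lemma coproductU c al : coproduct << c *g al >> = wcop al *~ c.
Proof. exact: free_evalU. Qed.

Lemma coproductM x y : coproduct (x * y) = coproduct x * coproduct y.
Proof. exact: free_evalM. Qed.

Definition wpair (phi : seq nat -> int) (x : NSym) : int :=
  \sum_(al <- msupp x) x@_al * phi al.

Lemma wpairB phi x y : wpair phi (x - y) = wpair phi x - wpair phi y.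
Proof.
apply: (@mlinB _ _ _ (fun (al : composition) (c : int) => c * phi al)) => k c d.
by rewrite mulrBl.
Qed.

Lemma wpairU phi c (al : composition) : wpair phi << c *g al >> = c * phi al.
Proof.
apply: (@mlinU _ _ _ (fun (al : composition) (c : int) => c * phi al)) => k x y.
by rewrite mulrBl.
Qed.

Definition wpair2 (phi psi : seq nat -> int) (t : {malg NSym[composition]}) : int :=
  \sum_(de <- msupp t) wpair phi t@_de * psi de.

Lemma wpair2_lin phi psi (k : composition) (c d : NSym) :
  wpair phi (c - d) * psi k = wpair phi c * psi k - wpair phi d * psi k.
Proof. by rewrite wpairB mulrBl. Qed.

Lemma wpair2B phi psi s t :
  wpair2 phi psi (s - t) = wpair2 phi psi s - wpair2 phi psi t.
Proof.
exact: (@mlinB _ _ _ (fun (de : composition) (x : NSym) => wpair phi x * psi de)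
  (wpair2_lin phi psi)).
Qed.

Lemma wpair2U phi psi (x : NSym) (de : composition) :
  wpair2 phi psi << x *g de >> = wpair phi x * psi de.
Proof.
exact: (@mlinU _ _ _ (fun (de : composition) (x : NSym) => wpair phi x * psi de)
  de x (wpair2_lin phi psi)).
Qed.

Lemma morphB_mulz (U V : zmodType) (f : U -> V) x (c : int) :
  (forall x y, f (x - y) = f x - f y) -> f (x *~ c) = f x *~ c.
Proof.
move=> B; pose fB := GRing.isZmodMorphism.Build U V f B.
pose fA : {additive U -> V} := HB.pack f fB.
exact: (raddfMz fA).
Qed.

Lemma wpair2_sum phi psi (I : Type) (r : seq I) (F : I -> {malg NSym[composition]}) :
  wpair2 phi psi (\sum_(i <- r) F i) = \sum_(i <- r) wpair2 phi psi (F i).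
Proof.
have Z : wpair2 phi psi 0 = 0 by have := wpair2B phi psi 0 0; rewrite !subrr.
have D s t : wpair2 phi psi (s + t) = wpair2 phi psi s + wpair2 phi psi t.
  have := wpair2B phi psi (s + t) t; rewrite addrK => ->; rewrite subrK //.
exact: (big_morph _ D Z).
Qed.

Lemma wpair_hM phi i x :
  wpair phi (nh i * x) = wpair (fun w => phi (hword i ++ w)) x.
Proof.
apply: (mlin_ext (f1 := fun x => wpair phi (nh i * x))
  (f2 := wpair (fun w => phi (hword i ++ w)))) => [g h|g h|c k].
- by rewrite malgMBr wpairB.
- exact: wpairB.
by rewrite malgMUU !wpairU mul1r fmM.
Qed.

Lemma wpair2_hhM phi psi i j t :
  wpair2 phi psi (tensor (nh i) (nh j) * t) =
  wpair2 (fun w => phi (hword i ++ w)) (fun w => psi (hword j ++ w)) t.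
Proof.
apply: (mlin_ext (f1 := fun t => wpair2 phi psi (tensor (nh i) (nh j) * t))
  (f2 := wpair2 (fun w => phi (hword i ++ w)) (fun w => psi (hword j ++ w))))
  => [g h|g h|x k].
- by rewrite malgMBr wpair2B.
- exact: wpair2B.
by rewrite /(nh j) tensorU mulr1z malgMUU !wpair2U wpair_hM fmM.
Qed.

Lemma wpair2_wcop phi psi (al : seq nat) :
  wpair2 phi psi (\prod_(k <- al) coproduct_h k.+1) = ssplit phi psi al.
Proof.
elim: al phi psi => [|k al IH] phi psi.
  rewrite big_nil /= (wpair2U phi psi 1 mone) (wpairU phi 1 mone) mul1r.
  by rewrite fm1.
rewrite big_cons /coproduct_h mulr_suml wpair2_sum ssplit_cons.
rewrite -[iota _ _]/(index_iota 0 k.+2) big_mkord.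
by apply: eq_bigr => i _; rewrite wpair2_hhM IH.
Qed.

Definition pairing2 (t : {malg NSym[composition]}) (a b : QSym) : int :=
  \sum_(de <- msupp t) pairing t@_de a * pairing << de >> b.

Lemma pairing2E t a b : pairing2 t a b =
  wpair2 (fun w => qsfun a (compmon w)) (fun w => qsfun b (compmon w)) t.
Proof. by apply: eq_bigr => de _; rewrite pairingU mul1r. Qed.

Lemma qsfunME (a b : QSym) m : qsfun (a * b) m = (qsfun a * qsfun b) m.
Proof. by []. Qed.

Lemma pairingMr x (a b : QSym) : pairing x (a * b) = pairing2 (coproduct x) a b.
Proof.
rewrite pairing2E.
apply: (mlin_ext (f1 := fun x => pairing x (a * b))
  (f2 := fun x => wpair2 _ _ (coproduct x))) => [g h|g h|c k].
- exact: pairingBl.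
- by rewrite coproductB wpair2B.
rewrite pairingU qsfunME (qsym_mulE _ (qsfunP a) (qsfunP b)) expseq_compmon.
by rewrite coproductU (morphB_mulz _ _ (wpair2B _ _)) wpair2_wcop -mulrzl intz.
Qed.

Lemma pairing2Bt s t a b : pairing2 (s - t) a b = pairing2 s a b - pairing2 t a b.
Proof. by rewrite !pairing2E wpair2B. Qed.

Lemma pairing2Br t a b c : pairing2 t a (b - c) = pairing2 t a b - pairing2 t a c.
Proof. by rewrite /pairing2 -sumrB; apply: eq_bigr => i _; rewrite pairingBr mulrBr. Qed.

Lemma pairing2Bl t a b c : pairing2 t (a - b) c = pairing2 t a c - pairing2 t b c.
Proof. by rewrite /pairing2 -sumrB; apply: eq_bigr => i _; rewrite pairingBr mulrBl. Qed.

Lemma pairing2U x de a b : pairing2 << x *g de >> a b = pairing x a * pairing << de >> b.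
Proof. by rewrite pairing2E wpair2U pairingU mul1r. Qed.

Lemma pairing2M s t a b : pairing2 (s * t) a b =
  \sum_(de <- msupp t) pairing2 s (Rstar t@_de a) (Rstar << de >> b).
Proof.
pose F (de : composition) (y : NSym) := pairing2 s (Rstar y a) (Rstar << de >> b).
have FB k x y : F k (x - y) = F k x - F k y by rewrite /F RstarBl pairing2Bl.
apply: (mlin_ext (f1 := fun t => pairing2 (s * t) a b)
  (f2 := fun t => \sum_(de <- msupp t) F de t@_de)) => [g h|g h|y de].
- by rewrite malgMBr pairing2Bt.
- exact: mlinB.
rewrite (mlinU _ _ FB) {FB}/F.
apply: (mlin_ext (f1 := fun s => pairing2 (s * << y *g de >>) a b)
  (f2 := fun s => pairing2 s (Rstar y a) (Rstar << de >> b))) => [g h|g h|x ga].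
- by rewrite malgMBl pairing2Bt.
- by rewrite pairing2Bt.
by rewrite malgMUU !pairing2U !Rstar_adjoint malgMUU mul1r.
Qed.

Lemma pairing_sum y (I : Type) (r : seq I) (F : I -> QSym) :
  pairing y (\sum_(i <- r) F i) = \sum_(i <- r) pairing y (F i).
Proof.
have Z : pairing y 0 = 0 by have := pairingBr y 0 0; rewrite !subrr.
have D a b : pairing y (a + b) = pairing y a + pairing y b.
  by have := pairingBr y (a + b) b; rewrite addrK => ->; rewrite subrK.
exact: (big_morph _ D Z).
Qed.

(* [^R x^*(a b)] is the sum of [^R x_(1)^*(a) ^R x_(2)^*(b)]: [QSym] is a left
   [NSym]-module algebra. *)
Lemma Rstar_mul x (a b : QSym) : Rstar x (a * b) =
  \sum_(de <- msupp (coproduct x))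
     Rstar (coproduct x)@_de a * Rstar << de >> b.
Proof.
apply: pairing_inj => y; rewrite Rstar_adjoint pairing_sum pairingMr coproductM.
by rewrite pairing2M; apply: eq_bigr => de _; rewrite pairingMr.
Qed.

(* [M_alpha], the sum of [x_{i_1}^{a_1} ... x_{i_r}^{a_r}] over [i_1 < ... < i_r] *)
Definition monomial_fun (alpha : composition) : fps :=
  fun m => (expseq m == alpha)%:R.

Fact monomial_subproof alpha : monomial_fun alpha \in qsymmetric.
Proof.
apply/qsymmetricP; split=> [m m' E|]; first by rewrite /monomial_fun E.
exists (sumn (map S alpha)) => m; rewrite /monomial_fun mdeg_expseq.
by case: (expseq m =P alpha) => // ->; rewrite ltnn.
Qed.

Definition monomial (alpha : composition) : QSym := MkQSym (monomial_subproof alpha).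

Lemma pairing_monomial (alpha beta : composition) :
  pairing << alpha >> (monomial beta) = (alpha == beta)%:R.
Proof.
rewrite pairingU mul1r /= /monomial_fun.
by rewrite (val_inj (expseq_compmon alpha) : expseq (compmon alpha) = alpha).
Qed.

(* [QSym (x) NSym] with the smash product, not with the product of the library's
   monoid algebra [{malg QSym[composition]}]; [sharp a x] is [a # x]. *)
Definition heis : Type := {malg QSym[composition]}.
HB.instance Definition _ := GRing.Zmodule.copy heis {malg QSym[composition]}.

Definition sharp (a : QSym) (x : NSym) : heis := tensor a x.

(* [(a # x)(b # y)], the sum of [a ^R x_(1)^*(b) # x_(2) y]; see [sharpM]. *)
Definition sharp_mul (a : QSym) (x : NSym) (b : QSym) (y : NSym) : heis :=
  \sum_(gamma <- msupp (coproduct x))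
     sharp (a * Rstar (coproduct x)@_gamma b) (<< gamma >> * y).

Definition heis_one : heis := sharp 1 1.
Definition heis_mul (u v : heis) : heis :=
  \sum_(alpha <- msupp u) \sum_(beta <- msupp v)
     sharp_mul u@_alpha << alpha >> v@_beta << beta >>.

(* [(a # x)(b) = a ^R x^*(b)]; see [heis_act_sharp]. *)
Definition heis_act (u : heis) (b : QSym) : QSym :=
  \sum_(alpha <- msupp u) u@_alpha * Rstar << alpha >> b.

Lemma heis_actB (b : QSym) (u v : heis) :
  heis_act (u - v) b = heis_act u b - heis_act v b.
Proof.
apply: (@mlinB composition _ _ (fun al c => c * Rstar << al >> b)) => k x y.
exact: mulrBl.
Qed.

Lemma heis_actU (b : QSym) c (al : composition) :
  heis_act << c *g al >> b = c * Rstar << al >> b.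
Proof.
apply: (@mlinU composition _ _ (fun al c => c * Rstar << al >> b)) => k x y.
exact: mulrBl.
Qed.

Lemma heis_act_sum (b : QSym) (I : Type) (r : seq I) (F : I -> heis) :
  heis_act (\sum_(i <- r) F i) b = \sum_(i <- r) heis_act (F i) b.
Proof.
have Z : heis_act 0 b = 0 by have := heis_actB b 0 0; rewrite !subrr.
have D (s t : heis) : heis_act (s + t) b = heis_act s b + heis_act t b.
  by have := heis_actB b (s + t) t; rewrite addrK => ->; rewrite subrK.
exact: (big_morph _ D Z).
Qed.

Lemma heis_actBr (u : heis) (a b : QSym) :
  heis_act u (a - b) = heis_act u a - heis_act u b.
Proof.
by rewrite /heis_act -sumrB; apply: eq_bigr => k _; rewrite RstarBr mulrBr.
Qed.

Lemma heis_actDr (u : heis) (I : Type) (r : seq I) (F : I -> QSym) :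
  heis_act u (\sum_(i <- r) F i) = \sum_(i <- r) heis_act u (F i).
Proof.
have Z : heis_act u 0 = 0 by have := heis_actBr u 0 0; rewrite !subrr.
have D (s t : QSym) : heis_act u (s + t) = heis_act u s + heis_act u t.
  by have := heis_actBr u (s + t) t; rewrite addrK => ->; rewrite subrK.
exact: (big_morph _ D Z).
Qed.

Lemma heis_act_sharp a x b : heis_act (sharp a x) b = a * Rstar x b.
Proof.
apply: (mlin_ext (f1 := fun x => heis_act (sharp a x) b)
  (f2 := fun x => a * Rstar x b)) => [g h|g h|c k].
- by rewrite /sharp tensorBr heis_actB.
- by rewrite RstarBl mulrBr.
rewrite /sharp tensorU heis_actU mulrzAl -mulrzAr; congr (a * _).
have -> : << c *g k >> = << k >> *~ c :> NSym.
  by rewrite -[in LHS](intz c); exact: (raddfMz (mkmalgU k)).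
by rewrite (morphB_mulz _ _ (fun x y => RstarBl x y b)).
Qed.

Lemma heis_act_sharp_mul a x b y c :
  heis_act (sharp_mul a x b y) c = heis_act (sharp a x) (heis_act (sharp b y) c).
Proof.
rewrite !heis_act_sharp heis_act_sum Rstar_mul big_distrr /=.
by apply: eq_bigr => de _; rewrite heis_act_sharp RstarM mulrA.
Qed.

Lemma heis_sharpE (u : heis) :
  u = \sum_(al <- msupp u) sharp u@_al << al >>.
Proof.
rewrite {1}[u]monalgE; apply: eq_bigr => al _.
by rewrite /sharp tensorU mulr1z.
Qed.

Lemma heis_actM u v b : heis_act (heis_mul u v) b = heis_act u (heis_act v b).
Proof.
rewrite /heis_mul heis_act_sum [in RHS](heis_sharpE u) heis_act_sum.
apply: eq_bigr => al _; rewrite heis_act_sum [in RHS](heis_sharpE v).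
rewrite heis_act_sum heis_actDr.
by apply: eq_bigr => be _; rewrite heis_act_sharp_mul.
Qed.

Lemma heis_act1 b : heis_act heis_one b = b.
Proof. by rewrite heis_act_sharp mul1r Rstar1. Qed.

Lemma Rstar_monomial (al be : composition) : (size al <= size be)%N ->
  Rstar << be >> (monomial al) = (al == be)%:R.
Proof.
move=> le; apply: val_inj; apply/funext => m /=.
rewrite /Rstar_fun malgMUU pairing_monomial.
have -> (B : bool) : qsfun B%:R m = (B && (m == mone))%:R.
  by case: B.
congr (nat_of_bool _)%:R; rewrite expseq_eq1.
apply/eqP/andP => [E|[/eqP-> /eqP->]]; last by rewrite mul1m.
have := congr1 (fun w : composition => size w) E.
rewrite fmM size_cat => sE.
have s0 : size (expseq m) = 0%N by move: le; rewrite -sE; lia.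
have m1 : expseq m = mone by apply: val_inj; rewrite /= fm1; apply: size0nil.
by rewrite -E m1 mul1m !eqxx.
Qed.

(* The action of [heis] on [QSym] is faithful. *)
Lemma heis_act_inj (u v : heis) : heis_act u =1 heis_act v -> u = v.
Proof.
move=> E; apply/eqP; rewrite -subr_eq0; apply/eqP.
have {E} : forall b, heis_act (u - v) b = 0 by move=> b; rewrite heis_actB E subrr.
move: (u - v) => {u v} u u0.
apply: contrapT => /eqP un0.
have : exists n, has (fun al : composition => size al == n) (msupp u).
  have /fset0Pn[al alu] : msupp u != fset0.
    by apply: contraNneq un0 => /eqP; rewrite msupp_eq0.
  by exists (size al); apply/hasP; exists al.
move=> /ex_minnP[n /hasP[al alu /eqP <-] min_al].
have := u0 (monomial al); rewrite /heis_act (big_fsetD1 al) //=.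
rewrite Rstar_monomial // eqxx mulr1 big1_fset ?addr0.
  by move/eqP; rewrite mcoeff_eq0 alu.
move=> be; rewrite in_fsetD1 => /andP[/negPf nbe beu] _.
rewrite Rstar_monomial ?[al == be]eq_sym ?nbe ?mulr0 //.
by apply: min_al; apply/hasP; exists be.
Qed.

Lemma heis_mulA : associative heis_mul.
Proof. by move=> u v w; apply: heis_act_inj => b; rewrite !heis_actM. Qed.
Lemma heis_mul1l : left_id heis_one heis_mul.
Proof. by move=> u; apply: heis_act_inj => b; rewrite heis_actM heis_act1. Qed.
Lemma heis_mul1r : right_id heis_one heis_mul.
Proof. by move=> u; apply: heis_act_inj => b; rewrite heis_actM heis_act1. Qed.

Lemma heis_actD (b : QSym) (u v : heis) :
  heis_act (u + v) b = heis_act u b + heis_act v b.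
Proof. by have := heis_actB b (u + v) v; rewrite addrK => ->; rewrite subrK. Qed.
Lemma heis_actDb (u : heis) (a b : QSym) :
  heis_act u (a + b) = heis_act u a + heis_act u b.
Proof. by have := heis_actBr u (a + b) b; rewrite addrK => ->; rewrite subrK. Qed.

Lemma heis_mulDl : left_distributive heis_mul +%R.
Proof.
by move=> u v w; apply: heis_act_inj => b; rewrite heis_actM !heis_actD !heis_actM.
Qed.
Lemma heis_mulDr : right_distributive heis_mul +%R.
Proof.
move=> u v w; apply: heis_act_inj => b.
by rewrite heis_actM !heis_actD heis_actDb !heis_actM.
Qed.
Lemma heis_oner_neq0 : heis_one != 0.
Proof.
apply/eqP => /(congr1 (fun u => heis_act u 1)); rewrite heis_act1.
have -> : heis_act 0 1 = 0 by have := heis_actB 1 0 0; rewrite !subrr.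
by move/eqP; rewrite oner_eq0.
Qed.
HB.instance Definition _ := GRing.Zmodule_isNzRing.Build heis
  heis_mulA heis_mul1l heis_mul1r heis_mulDl heis_mulDr heis_oner_neq0.

Lemma sharpM a x b y : sharp a x * sharp b y = sharp_mul a x b y.
Proof.
by apply: heis_act_inj => c; rewrite heis_actM heis_act_sharp_mul.
Qed.

Definition symmetric_series (f : fps) : Prop :=
  forall s : nat -> nat, bijective s ->
  forall m m' : mon, (forall i, m' (s i) = m i) -> f m = f m'.

(* [e_n], the sum of [x_{i_1} ... x_{i_n}] over [i_1 < ... < i_n], which is
   [M_alpha] for [alpha = (1, ..., 1)] with [n] parts; in particular [e_0 = 1]. *)
Definition elementary (n : nat) : QSym := monomial (FMonom (nseq n 0%N)).

(* As algebras are over Z, the subalgebra generated by a set is the subring it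
   generates. *)
Inductive subalgebra_generated (R : nzRingType) (S : R -> Prop) : R -> Prop :=
| subalgebra_gen u : S u -> subalgebra_generated S u
| subalgebra_1 : subalgebra_generated S 1
| subalgebra_B u v : subalgebra_generated S u -> subalgebra_generated S v ->
    subalgebra_generated S (u - v)
| subalgebra_M u v : subalgebra_generated S u -> subalgebra_generated S v ->
    subalgebra_generated S (u * v).

Inductive ideal_generated (R : nzRingType) (S : R -> Prop) : R -> Prop :=
| ideal_gen u : S u -> ideal_generated S u
| ideal_0 : ideal_generated S 0
| ideal_B u v : ideal_generated S u -> ideal_generated S v ->
    ideal_generated S (u - v)
| ideal_Ml u v : ideal_generated S v -> ideal_generated S (u * v)
| ideal_Mr u v : ideal_generated S u -> ideal_generated S (u * v).

Definition qproj : heis -> Prop :=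
  subalgebra_generated (fun u =>
    (exists x : NSym, u = sharp 1 x) \/
    (exists a : QSym, symmetric_series (qsfun a) /\ u = sharp a 1)).

Definition extend0 (R : zmodType) (f : nat -> R) (n : int) : R :=
  if n is Posz k then f k else 0.

Definition qe : int -> heis := extend0 (fun n => sharp (elementary n) 1).
Definition qh : int -> heis := extend0 (fun n => sharp 1 (nh n)).

(* The free algebra on symbols [E_n, H_n] with [n >= 1]: the letter [inl k] is
   [E_{k+1}] and [inr k] is [H_{k+1}]. The conventions [E_0 = H_0 = 1] and
   [E_n = H_n = 0] for [n < 0] are built into [free_e] and [free_h]. *)
Notation free_alg := {malg int[{fmonom (nat + nat)%type}]}.

Definition free_e : int -> free_alg :=
  extend0 (fun n => if n is k.+1 then << FMonom [:: inl k] >> else 1).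
Definition free_h : int -> free_alg :=
  extend0 (fun n => if n is k.+1 then << FMonom [:: inr k] >> else 1).

(* The algebra morphism with [E_n |-> e_n] and [H_n |-> ^R h_n^*] *)
Definition presentation_map : free_alg -> heis :=
  free_eval (fun i : nat + nat =>
    match i with inl k => qe k.+1 | inr k => qh k.+1 end).

Definition commutator (R : nzRingType) (x y : R) : R := x * y - y * x.

Inductive relator : free_alg -> Prop :=
| relator_ee (n k : nat) : relator (commutator (free_e n) (free_e k))
| relator_he (n k : nat) :
    relator (commutator (free_h n) (free_e k)
             - free_e (k%:Z - 1) * free_h (n%:Z - 1)).

Lemma elementary0 : elementary 0 = 1.
Proof.
apply: val_inj; apply/funext => m /=; rewrite /monomial_fun fps1E expseq_eq1.
by congr (nat_of_bool (_ == _))%:R; apply: val_inj; rewrite /= fm1.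
Qed.

Lemma nh0 : nh 0 = 1.
Proof. by rewrite /nh (_ : FMonom _ = mone) //; apply: val_inj; rewrite /= fm1. Qed.

Lemma qe0 : qe 0 = 1. Proof. by rewrite /qe /= elementary0. Qed.
Lemma qh0 : qh 0 = 1. Proof. by rewrite /qh /= nh0. Qed.

Lemma presentation_map_e n : presentation_map (free_e n) = qe n.
Proof.
case: n => [[|k]|k]; rewrite /presentation_map /=.
- exact: etrans (free_eval1 _) (esym qe0).
- exact: free_eval_letter.
- exact: raddf0.
Qed.

Lemma presentation_map_h n : presentation_map (free_h n) = qh n.
Proof.
case: n => [[|k]|k]; rewrite /presentation_map /=.
- exact: etrans (free_eval1 _) (esym qh0).
- exact: free_eval_letter.
- exact: raddf0.
Qed.

(* Main.v *)
Require Import Defs.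
From mathcomp Require Import all_boot all_order all_algebra.
From mathcomp Require Import finmap boolp.
From mathcomp Require Import monalg zify.

(* For the relation between [h_n] and [e_k], expand [^R h_n^*(e_k b)] with the
   coproduct of [h_n]: only [^R h_0^*(e_k) = e_k] and [^R h_1^*(e_k) = e_{k-1}]
   are non-zero.

   The relations rewrite every word in the generators into a combination of words
   [E_{s_1} ... E_{s_p} H_{t_1} ... H_{t_q}] with [s] sorted. The image of such a
   word is [e_s # h_t], so the kernel is no larger than the ideal as soon as the
   products [e_s] are linearly independent in [QSym]. In the lexicographic order,
   [e_s] has a leading monomial with coefficient [1], and this monomial determines
   [s].

   The leading monomial of a symmetric function is a partition, hence the leading
   monomial of some [e_s]; subtracting multiples of such products shows that the
   [e_n] generate [Sym]. *)

Set Implicit Arguments.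
Unset Strict Implicit.
Unset Printing Implicit Defensive.

Import GRing.Theory.
Local Open Scope fset_scope.
Local Open Scope ring_scope.

(** * The smash product relations *)

Lemma heis_act_mul (u v : heis) b : heis_act (u * v) b = heis_act u (heis_act v b).
Proof. exact: heis_actM. Qed.

Lemma sharp1M x y : sharp 1 (x * y) = sharp 1 x * sharp 1 y.
Proof.
apply: heis_act_inj => b.
by rewrite [LHS]heis_act_sharp [RHS]heis_act_mul [RHS]heis_act_sharp
  [in RHS]heis_act_sharp RstarM !mul1r.
Qed.

Lemma sharpM1 a b : sharp (a * b) 1 = sharp a 1 * sharp b 1.
Proof.
apply: heis_act_inj => c.
by rewrite [LHS]heis_act_sharp [RHS]heis_act_mul [RHS]heis_act_sharp
  [in RHS]heis_act_sharp !Rstar1 mulrA.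
Qed.

Lemma sharpE a x : sharp a x = sharp a 1 * sharp 1 x.
Proof.
apply: heis_act_inj => c.
by rewrite [LHS]heis_act_sharp [RHS]heis_act_mul [RHS]heis_act_sharp
  [in RHS]heis_act_sharp Rstar1 mul1r.
Qed.

Lemma sharp_word a (al : composition) : sharp a << al >> = << a *g al >>.
Proof. by rewrite /sharp tensorU mulr1z. Qed.

Lemma coproduct_nh n : coproduct (nh n) = coproduct_h n.
Proof.
case: n => [|n]; last by rewrite /coproduct free_eval_letter.
rewrite /coproduct nh0 free_eval1 /coproduct_h big_ord1 subn0 nh0.
by rewrite (tensorU 1 1 mone) mulr1z.
Qed.

(** The coproduct of [nh n] is a sum of pure tensors, and the summand [F] of [Rstar_mul] is additive
    in its tensor, so the sum can be evaluated tensor by tensor. *)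
Lemma Rstar_nh_mul n a b : Rstar (nh n) (a * b) =
  \sum_(i < n.+1) Rstar (nh i) a * Rstar (nh (n - i)) b.
Proof.
rewrite Rstar_mul coproduct_nh /coproduct_h.
pose F (de : composition) (x : NSym) := Rstar x a * Rstar << de >> b.
have FB k x y : F k (x - y) = F k x - F k y by rewrite /F RstarBl mulrBl.
pose G (t : {malg NSym[composition]}) := \sum_(de <- msupp t) F de t@_de.
have GB s t : G (s - t) = G s - G t by exact: mlinB.
have G0 : G 0 = 0 by have := GB 0 0; rewrite !subrr.
have GD s t : G (s + t) = G s + G t.
  by have := GB (s + t) t; rewrite addrK => ->; rewrite subrK.
rewrite -/(G _) (big_morph G GD G0); apply: eq_bigr => i _.
by rewrite /(nh (n - i)) tensorU mulr1z /G (mlinU _ _ FB).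
Qed.

Lemma elementaryE n m : qsfun (elementary n) m = (expseq m == nseq n 0%N :> seq nat)%:R.
Proof. by []. Qed.

(** For positive [n], the coefficient at $M_\beta$ on the left is that of $M_{(1^k)}$ at $\beta$
    followed by the part [n]. A word $(1^k)$ can only end in the part $1$, whose letter is [0]. *)
Lemma Rstar_nh_elementary n k : Rstar (nh n) (elementary k) =
  if n is n'.+1 then if (n' == 0%N) && (0 < k)%N then elementary k.-1 else 0
  else elementary k.
Proof.
case: n => [|n]; first by rewrite nh0 Rstar1.
apply: val_inj; apply/funext => m.
rewrite [LHS]RstarE malgMUU mul1r pairingU mul1r elementaryE expseq_compmon fmM.
case: k => [|k] /=.
  by rewrite andbF /=; case: (expseq m : seq nat).
rewrite andbT -[0%N :: nseq k 0%N]/(nseq k.+1 0%N) -addn1 nseqD /= cats1 cats1.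
rewrite eqseq_rcons.
case: (n =P 0%N) => _; last by rewrite andbF.
by rewrite andbT elementaryE.
Qed.

Lemma heis_act_qe (j : int) b : heis_act (qe j) b = extend0 elementary j * b.
Proof.
case: j => j; first by rewrite heis_act_sharp Rstar1.
by rewrite mul0r /heis_act msupp0 big_seq_fset0.
Qed.

Lemma heis_act_qh (j : int) b :
  heis_act (qh j) b = extend0 (fun n => Rstar (nh n) b) j.
Proof.
case: j => j; first by rewrite heis_act_sharp mul1r.
by rewrite /heis_act msupp0 big_seq_fset0.
Qed.

Lemma PoszS_sub1 (n : nat) : n.+1%:Z - 1 = n.
Proof. by lia. Qed.

Lemma qh_qe_commutator (n k : nat) :
  commutator (qh n) (qe k) = qe (k%:Z - 1) * qh (n%:Z - 1).
Proof.
apply: heis_act_inj => b; rewrite /commutator heis_actB.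
have E1 : heis_act (qh n * qe k) b = Rstar (nh n) (elementary k * b).
  by rewrite [LHS]heis_act_mul [LHS]heis_act_qh heis_act_qe.
have E2 : heis_act (qe k * qh n) b = elementary k * Rstar (nh n) b.
  by rewrite [LHS]heis_act_mul [LHS]heis_act_qe heis_act_qh.
apply: etrans (congr2 (fun x y => x - y) E1 E2) _.
rewrite {E1 E2} [RHS]heis_act_mul [RHS]heis_act_qe heis_act_qh.
rewrite Rstar_nh_mul.
(* The summand [i = 0] is [elementary k * Rstar (nh n) b] and cancels the second product of the
   commutator. *)
rewrite big_ord_recl subn0 nh0 Rstar1.
rewrite addrAC subrr add0r.
(* For [n = 0] no summand is left, and on the right [qh (-1)] is zero. *)
case: n => [|n]; first by rewrite big_ord0 mulr0.
rewrite big_ord_recl big1 => [|i _]; last by rewrite Rstar_nh_elementary mul0r.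
rewrite addr0 PoszS_sub1 Rstar_nh_elementary lift0 subSS subn0.
case: k => [|k]; first by rewrite !mul0r.
by rewrite PoszS_sub1.
Qed.

Lemma qe_commutator (n k : nat) : commutator (qe n) (qe k) = 0.
Proof. by rewrite /commutator -!sharpM1 mulrC subrr. Qed.

(** * Leading monomials *)

Definition lexlt (m m' : mon) : Prop :=
  exists2 i, forall j, (j < i)%N -> m j = m' j & (m i < m' i)%N.

Lemma lexlt_trans m1 m2 m3 : lexlt m1 m2 -> lexlt m2 m3 -> lexlt m1 m3.
Proof.
move=> [i eq12 lt12] [j eq23 lt23]; case: (ltngtP i j) => [ij|ji|ij].
- exists i => [k ki|]; first by rewrite eq12 // eq23 // (ltn_trans ki).
  by rewrite -eq23.
- exists j => [k kj|]; first by rewrite eq12 ?eq23 // (ltn_trans kj).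
  by rewrite eq12.
- exists i => [k ki|]; first by rewrite eq12 // eq23 // -ij.
  by rewrite (ltn_trans lt12) // ij.
Qed.

Lemma lexltnn m : ~ lexlt m m.
Proof. by move=> [i _]; rewrite ltnn. Qed.

Lemma lexlt_total m m' : [\/ m = m', lexlt m m' | lexlt m' m].
Proof.
have [->|/cmP ne] := eqVneq m m'; first by constructor 1.
have ex : exists i, m i != m' i.
  by apply: contrapT => nex; apply: ne => i; apply/eqP/contraT => ?; case: nex; exists i.
case: (ex_minnP ex) => i; rewrite neq_ltn => nei min_i.
have eq j : (j < i)%N -> m j = m' j.
  by move=> ji; apply/eqP; apply: contraTT ji => /min_i; rewrite -leqNgt.
case/orP: nei => lt; [constructor 2|constructor 3]; exists i => // j ji.
by rewrite eq.
Qed.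

Lemma lexlt_mull m m1 m2 : lexlt m1 m2 -> lexlt (mmul m m1) (mmul m m2).
Proof.
move=> [i eq lt]; exists i => [j ji|]; rewrite !cmM; first by rewrite eq.
by rewrite ltn_add2l.
Qed.

(** By [lexlt_total], the negated hypothesis is a weak inequality, stated in the form in which
    proofs by contradiction supply it. *)
Lemma lexltM m1 m2 n1 n2 : lexlt m1 m2 -> ~ lexlt n2 n1 ->
  lexlt (mmul m1 n1) (mmul m2 n2).
Proof.
move=> lt_m nlt_n; rewrite [mmul m1 _]mulmC [mmul m2 _]mulmC.
case: (lexlt_total n1 n2) => [->|lt_n|//]; first exact: lexlt_mull.
apply: lexlt_trans (lexlt_mull n1 lt_m) _.
by rewrite [mmul n1 _]mulmC [mmul n2 _]mulmC; apply: lexlt_mull.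
Qed.

(** A leading coefficient [1] survives products and lets any integer coefficient at [m] be cancelled
    by a multiple of [f]. *)
Definition lead (f : fps) (m : mon) : Prop :=
  f m = 1 /\ forall m', lexlt m m' -> f m' = 0.

Lemma lead1 : lead 1 mone.
Proof.
split=> [|m' [i _]]; first by rewrite fps1E eqxx.
by rewrite fps1E; case: eqP => // ->; rewrite cm1.
Qed.

Lemma mmul_divcm (m d : mon) : d \in mdivisors m -> mmul d (divcm m d) = m.
Proof.
by move=> /mdivisorsP le; apply/eqP/cmP => i; rewrite cmM divcmE subnKC.
Qed.

(** If [mmul d d'] is at least [mmul m n], then [d] exceeds [m], or [d'] exceeds [n], or both pairs
    agree. So only one product survives at [mmul m n], and none above it. *)
Lemma leadM f g m n : lead f m -> lead g n -> lead (f * g) (mmul m n).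
Proof.
move=> [fm f0] [gn g0].
have coef0 (d d' : mon) : lexlt m d \/ lexlt n d' -> f d * g d' = 0.
  by case=> [/f0->|/g0->]; rewrite ?mul0r ?mulr0.
split=> [|p lt_p]; rewrite fpsME.
  have mD : m \in mdivisors (mmul m n) by apply/mdivisorsP => i; rewrite cmM leq_addr.
  have -> : (\sum_(d <- mdivisors (mmul m n)) f d * g (divcm (mmul m n) d) =
             f m * g (divcm (mmul m n) m)).
    rewrite (big_fsetD1 m) //= big1_fset ?addr0 // => d.
    rewrite in_fsetD1 => /andP[/eqP nd dD] _; apply: coef0.
    case: (lexlt_total m d) => [E|lt|lt]; [by case: nd | by left | right].
    apply: contrapT => nlt; have := lexltM lt nlt.
    by rewrite (mmul_divcm dD) => /lexltnn.
  have -> : divcm (mmul m n) m = n by apply/eqP/cmP => i; rewrite divcmE cmM addKn.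
  by rewrite fm gn.
rewrite big_seq big1 // => d dD; apply: coef0.
apply: contrapT => /not_orP[Nm Nn]; rewrite -(mmul_divcm dD) in lt_p.
case: (lexlt_total m d) => [E|//|lt]; last first.
  exact: lexltnn (lexlt_trans (lexltM lt Nn) lt_p).
case: (lexlt_total n (divcm p d)) => [E'|//|lt].
  by move: lt_p; rewrite E {1}E' => /lexltnn.
by move: lt_p; rewrite E => /(lexlt_trans (lexlt_mull d lt))/lexltnn.
Qed.

(* The leading monomial of [e_n] is [x_1 ... x_n]. *)
Definition stair (n : nat) : mon := compmon (nseq n 0%N).

Lemma stairE n i : stair n i = (i < n)%N.
Proof.
rewrite compmonE map_nseq nth_nseq; by case: ltnP.
Qed.

(** This form does not refer to the order of the variables, so symmetry can be read off from it. *)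
Lemma elementary_coef n m :
  qsfun (elementary n) m = ([forall i : finsupp m, m (val i) == 1%N] &&
    (#|`finsupp m| == n))%:R.
Proof.
rewrite elementaryE; congr (nat_of_bool _)%:R.
rewrite expseq.unlock /=.
apply/eqP/andP => [E|[/forallP m1 /eqP <-]].
  split; last by move/(congr1 size): E; rewrite size_map size_sort size_nseq => ->.
  apply/forallP => i; have im := valP i.
  have : (m (val i)).-1 \in [seq (m i).-1 | i <- sort leq (finsupp m)].
    by apply: map_f; rewrite mem_sort.
  rewrite E mem_nseq => /andP[_ /eqP m0].
  have : m (val i) != 0%N by rewrite cmE_neq0.
  by case: (m (val i)) m0 => //= k ->.
apply: (@eq_from_nth _ 0%N); first by rewrite size_map size_sort size_nseq.
move=> i; rewrite size_map size_sort nth_nseq => lt.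
rewrite lt (nth_map 0%N) ?size_sort //.
have im : nth 0%N (sort leq (finsupp m)) i \in finsupp m.
  by rewrite -(mem_sort leq) mem_nth ?size_sort.
by have /eqP /= -> := m1 [` im].
Qed.

(** A larger monomial with all exponents at most [1] must contain the first [n] variables and a
    further one, hence too many variables. *)
Lemma lead_elementary n : lead (qsfun (elementary n)) (stair n).
Proof.
split=> [|m [i eqi lti]].
  by rewrite elementaryE expseq_compmon eqxx.
rewrite elementary_coef; case: forallP => //= m1; case: eqP => // sz; exfalso.
have : (size (iota 0 n.+1) <= size (finsupp m))%N; last first.
  by rewrite size_iota sz ltnn.
have ge_in : (n <= i)%N.
  rewrite leqNgt; apply/negP => ltin; rewrite stairE ltin in lti.
  have im : i \in finsupp m by rewrite -cmE_neq0 -lt0n (leq_trans _ lti).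
  by have /eqP /= E := m1 [` im]; rewrite E in lti.
pose s := i :: iota 0 n.
have -> : size (iota 0 n.+1) = size s by rewrite /s /= !size_iota.
apply: uniq_leq_size.
  by rewrite /= iota_uniq mem_iota add0n -leqNgt ge_in.
move=> j; rewrite inE mem_iota add0n -cmE_neq0 => /predU1P[->|/= ltj].
  by rewrite -lt0n (leq_trans _ lti).
by rewrite -eqi ?stairE ?ltj // (leq_trans ltj).
Qed.

Definition eprod (s : seq nat) : QSym := \prod_(k <- s) elementary k.+1.

Definition eprod_lm (s : seq nat) : mon := foldr (fun k => mmul (stair k.+1)) mone s.

Lemma lead_eprod s : lead (qsfun (eprod s)) (eprod_lm s).
Proof.
rewrite /eprod; elim: s => [|k s IH]; first by rewrite big_nil; exact: lead1.
by rewrite big_cons; exact: leadM (lead_elementary _) IH.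
Qed.

(** These exponents form the partition conjugate to the one with parts [k.+1] for [k] in [s]. *)
Lemma eprod_lmE s i : eprod_lm s i = count (leq i) s.
Proof.
elim: s => [|k s IH]; first by rewrite cm1.
by rewrite [eprod_lm _]/= cmM IH stairE ltnS.
Qed.

(** The multiplicity of a letter is the difference of two consecutive exponents. *)
Lemma eprod_lm_inj s t : eprod_lm s = eprod_lm t -> perm_eq s t.
Proof.
have C u i : count (leq i) u = (count_mem i u + count (leq i.+1) u)%N.
  by elim: u => //= k u ->; case: ltngtP => _ /=; lia.
move=> E; apply/allP => i _ /=.
have [Es Et] := (C s i, C t i).
by move: Es Et; rewrite -!eprod_lmE E => -> /addIn ->.
Qed.

(** * Generation of the symmetric functions *)

Section Reindexing.
Variables (s t : nat -> nat).
Hypotheses (sK : cancel s t) (tK : cancel t s).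

Definition mperm (m : mon) : mon := [cmonom m (t j) | j in [fset s i | i in finsupp m]]%M.

Lemma mpermE m j : mperm m j = m (t j).
Proof.
rewrite cmE fsfun_fun; case: ifPn => // jm; apply/esym/eqP.
rewrite cmE_eq0; apply: contra jm => tjm; apply/imfsetP.
by exists (t j); rewrite ?tK.
Qed.

Lemma mperm_inj : injective mperm.
Proof.
move=> m m' /eqP/cmP E; apply/eqP/cmP => i.
by have := E (s i); rewrite !mpermE sK.
Qed.

(** Turns the relation between monomials in [symmetric_series] into an equation that can be
    substituted. *)
Lemma mpermP (m m' : mon) : (forall i, m' (s i) = m i) -> m' = mperm m.
Proof. by move=> E; apply/eqP/cmP => j; rewrite mpermE -E tK. Qed.

Lemma mdivisors_perm m :
  perm_eq (mdivisors (mperm m)) [seq mperm d | d <- mdivisors m].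
Proof.
apply: uniq_perm; rewrite ?(map_inj_uniq mperm_inj) ?fset_uniq // => d.
apply/mdivisorsP/mapP => [le|[d' /mdivisorsP le ->] i]; last by rewrite !mpermE.
pose d' : mon := [cmonom d (s i) | i in [fset t j | j in finsupp d]]%M.
have d'E i : d' i = d (s i).
  rewrite cmE fsfun_fun; case: ifPn => // im; apply/esym/eqP.
  rewrite cmE_eq0; apply: contra im => sim; apply/imfsetP.
  by exists (s i); rewrite ?sK.
exists d'; last by apply: mpermP => i.
by apply/mdivisorsP => i; rewrite d'E -[m i](congr1 m (sK i)) -mpermE.
Qed.

Lemma divcm_perm m d : divcm (mperm m) (mperm d) = mperm (divcm m d).
Proof. by apply/eqP/cmP => j; rewrite divcmE !mpermE divcmE. Qed.

Lemma finsupp_perm m : finsupp (mperm m) = [fset s i | i in finsupp m].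
Proof.
apply/fsetP => j; rewrite -cmE_neq0 mpermE cmE_neq0.
apply/idP/imfsetP => [tj|[i /= im ->]]; last by rewrite sK.
by exists (t j); rewrite ?tK.
Qed.

End Reindexing.

(** Renaming the variables carries the factorisations of a monomial bijectively to those of its
    image. *)
Lemma symmetric_seriesM f g :
  symmetric_series f -> symmetric_series g -> symmetric_series (f * g).
Proof.
move=> fs gs s sbij m m' /[dup] E.
have [t sK tK] := sbij; move/(mpermP tK) => ->.
rewrite !fpsME (perm_big _ (mdivisors_perm sK tK m)) big_map.
apply: eq_bigr => d _; rewrite (divcm_perm tK).
by congr (_ * _); [apply: fs sbij _ _ _ | apply: gs sbij _ _ _] => i;
  rewrite (mpermE tK) sK.
Qed.

Lemma symmetric_elementary n : symmetric_series (qsfun (elementary n)).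
Proof.
move=> s sbij m m' /[dup] E.
have [t sK tK] := sbij; move/(mpermP tK) => ->.
rewrite !elementary_coef finsupp_perm // card_imfset /=; last exact: can_inj sK.
congr (nat_of_bool (_ && _))%:R.
apply/forallP/forallP => h i.
  rewrite (mpermE tK); have /imfsetP[j /= jm ->] := valP i.
  by rewrite sK; exact: h [` jm].
have im : s (val i) \in [fset s j | j in finsupp m] by apply/in_imfset/valP.
by have := h [` im]; rewrite /= (mpermE tK) sK.
Qed.

Lemma symmetric_eprod w : symmetric_series (qsfun (eprod w)).
Proof.
rewrite /eprod; elim: w => [|k w IH].
  move=> s sbij m m' /[dup] E; rewrite big_nil /= !fps1E.
  have [t sK tK] := sbij; move/(mpermP tK) => ->; congr (nat_of_bool _)%:R.
  apply/eqP/eqP => [->|/eqP/cmP E1]; apply/eqP/cmP => i.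
    by rewrite (mpermE tK) !cm1.
  by have := E1 (s i); rewrite (mpermE tK) sK !cm1.
by rewrite big_cons; apply: symmetric_seriesM IH; exact: symmetric_elementary.
Qed.

(** * Degree bounds and partitions as leading monomials *)

Definition degree_le (f : fps) (n : nat) : Prop :=
  forall m : mon, (n < mdeg m)%N -> f m = 0.

Lemma degree_leM f g n n' : degree_le f n -> degree_le g n' ->
  degree_le (f * g) (n + n').
Proof.
move=> fn gn m ltm; rewrite fpsME big_seq big1 // => d dm.
have [lt|le] := ltnP n (mdeg d); first by rewrite fn // mul0r.
by rewrite gn ?mulr0 //; move: ltm; rewrite (mdeg_divcm dm); lia.
Qed.

(** Guarantees that subtracting a multiple of [eprod w] to cancel a monomial does not raise the
    degree bound. *)
Lemma degree_eprod w : degree_le (qsfun (eprod w)) (mdeg (eprod_lm w)).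
Proof.
rewrite /eprod; elim: w => [|k w IH].
  by move=> m; rewrite big_nil mdeg1 lt0n mdeg_eq0 => /negPf m1; rewrite /= fps1E m1.
rewrite big_cons [eprod_lm _]/= mdegM; apply: (degree_leM (f := qsfun _)) IH => m.
rewrite !mdeg_expseq expseq_compmon elementaryE => lt.
by case: eqP lt => // ->; rewrite ltnn.
Qed.

(** Builds the conjugate partition from the last exponent backwards: each drop from [m j] to
    [m j.+1] is the multiplicity of the letter [j]. *)
Lemma eprod_lm_surj (m : mon) N : (forall i, m i.+1 <= m i)%N ->
  (forall i, (N <= i)%N -> m i = 0%N) -> exists w, eprod_lm w = m.
Proof.
move=> m_decr m0.
(* After [d] steps the exponents from index [N - d] on are correct; below that index the count is
   still constant, whence the [maxn]. *)
have H d : exists w, forall i, count (leq i) w = m (maxn i (N - d)).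
  elim: d => [|d [w IH]].
    by exists [::] => i; rewrite subn0 m0 ?leq_maxr.
  have [ltdN|leNd] := ltnP d N; last first.
    exists w => i; rewrite IH; congr (m (maxn _ _)); lia.
  set j := (N - d.+1)%N; have jE : (N - d = j.+1)%N by rewrite /j; lia.
  exists (nseq (m j - m j.+1) j ++ w) => i.
  rewrite count_cat count_nseq IH jE; have := m_decr j.
  case: (leqP i j) => [le|lt] lej.
    by rewrite (maxn_idPr (leqW le)) mul1n subnK.
  by rewrite mul0n add0n (maxn_idPl lt).
have [w wE] := H N; exists w; apply/eqP/cmP => i.
by rewrite eprod_lmE wE subnn maxn0.
Qed.

(* The first [n] exponents of [m] as digits in base [B]: on bounded exponents,
   this realises the lexicographic order inside [nat]. *)
Fixpoint code (B n : nat) (m : mon) : nat :=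
  if n is n'.+1 then (B * code B n' m + m n')%N else 0%N.

(** Later digits of [m] are below [B], so they cannot make up for a smaller earlier digit. *)
Lemma code_lt B n i (m m' : mon) : (forall j, m j < B)%N -> (i < n)%N ->
  (forall j, (j < i)%N -> m j = m' j) -> (m i < m' i)%N ->
  (code B n m < code B n m')%N.
Proof.
move=> ltB ltin eqi lti; elim: n ltin => // n IH; rewrite ltnS leq_eqVlt.
case/predU1P => [<-|/IH lt] /=; last first.
  apply: (@leq_trans (B * (code B n m).+1)).
    by rewrite mulnS addnC ltn_add2r.
  by rewrite (leq_trans _ (leq_addr _ _)) // leq_mul2l lt orbT.
suff -> : code B i m = code B i m' by rewrite ltn_add2l.
elim: {-2}i (leqnn i) => //= k IHk lt; rewrite IHk ?eqi //; exact: ltnW.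
Qed.

Lemma code_bound B n (m : mon) : (forall j, m j < B)%N -> (code B n m < B ^ n)%N.
Proof.
move=> ltB; elim: n => [|n IH]; first by rewrite expn0.
rewrite expnS /=; apply: (@leq_trans (B * (code B n m).+1)).
  by rewrite mulnS addnC ltn_add2r.
by rewrite leq_mul2l IH orbT.
Qed.

(** A finite set of monomials, on which [code N.+1 N] is strictly increasing; it contains a
    representative of every composition of size at most [N]. *)
Definition bounded_mon (N : nat) (m : mon) : Prop :=
  forall i, (m i <= N)%N /\ ((N <= i)%N -> m i = 0%N).

Lemma bounded_lexlt N m m' : bounded_mon N m -> bounded_mon N m' ->
  lexlt m m' -> (code N.+1 N m < code N.+1 N m')%N.
Proof.
move=> bm bm' [i eqi lti]; apply: (code_lt (i := i)) => // [j|].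
  by rewrite ltnS; case: (bm j).
by rewrite ltnNge; apply/negP => /(bm' i).2 E; rewrite E in lti.
Qed.

Lemma bounded_compmon N m : (mdeg m <= N)%N -> bounded_mon N (compmon (expseq m)).
Proof.
rewrite mdeg_expseq; move: (expseq m : seq nat) => w le i.
rewrite compmonE; split=> [|leN].
  apply: leq_trans le; elim: w i => [|k w IH] [|i] //=.
    exact: leq_addr.
  exact: leq_trans (IH i) (leq_addl _ _).
rewrite nth_default // size_map; apply: leq_trans leN; apply: leq_trans le.
by elim: w => //= k w IH; rewrite addSn ltnS (leq_trans IH) // leq_addl.
Qed.

(** * Closure properties of generated subalgebras *)

Section Subalgebra.
Variables (R : nzRingType) (S : R -> Prop).
Let gen := subalgebra_generated S.

Lemma subalgebra_0 : gen 0.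
Proof. by rewrite -(subrr 1); apply: subalgebra_B; apply: subalgebra_1. Qed.

Lemma subalgebra_D u v : gen u -> gen v -> gen (u + v).
Proof.
move=> gu gv; rewrite -(opprK v) -(sub0r v); apply: subalgebra_B => //.
by apply: subalgebra_B => //; exact: subalgebra_0.
Qed.

Lemma subalgebra_mulz u c : gen u -> gen (u *~ c).
Proof.
move=> gu; have gn n : gen (u *+ n).
  elim: n => [|n IH]; first by rewrite mulr0n; exact: subalgebra_0.
  by rewrite mulrS; apply: subalgebra_D.
case: c => n; first by rewrite -pmulrn; exact: gn.
by rewrite NegzE mulrNz -pmulrn -sub0r; apply: subalgebra_B; [exact: subalgebra_0|exact: gn].
Qed.

Lemma subalgebra_sum (I : Type) (r : seq I) (F : I -> R) :
  (forall i, gen (F i)) -> gen (\sum_(i <- r) F i).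
Proof.
by move=> gF; apply: (big_ind gen) => //; [exact: subalgebra_0|exact: subalgebra_D].
Qed.

Lemma subalgebra_prod (I : Type) (r : seq I) (F : I -> R) :
  (forall i, gen (F i)) -> gen (\prod_(i <- r) F i).
Proof.
by move=> gF; apply: (big_ind gen) => //; [exact: subalgebra_1|exact: subalgebra_M].
Qed.
End Subalgebra.

Lemma subalgebra_morph (R R' : nzRingType) (f : R -> R') (S : R -> Prop) (S' : R' -> Prop) :
  f 1 = 1 -> (forall u v, f (u - v) = f u - f v) -> (forall u v, f (u * v) = f u * f v) ->
  (forall u, S u -> subalgebra_generated S' (f u)) ->
  forall u, subalgebra_generated S u -> subalgebra_generated S' (f u).
Proof.
move=> f1 fB fM fS u; elim=> {u} [u /fS//||u v _ Iu _ Iv|u v _ Iu _ Iv].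
- by rewrite f1; exact: subalgebra_1.
- by rewrite fB; exact: subalgebra_B.
- by rewrite fM; exact: subalgebra_M.
Qed.

(* Otherwise, exchanging [x_i] and [x_{i+1}] gives a larger monomial with the same
   coefficient. *)
Lemma symmetric_decreasing (f : fps) N (m : mon) : symmetric_series f ->
  bounded_mon N m -> f m != 0 ->
  (forall m', bounded_mon N m' -> lexlt m m' -> f m' = 0) ->
  forall i, (m i.+1 <= m i)%N.
Proof.
move=> fs bm fm0 top i; rewrite leqNgt; apply/negP => lti.
(* The exchanged variables both have index below [N], so the exchanged monomial stays bounded. *)
have ltiN : (i.+1 < N)%N.
  by rewrite ltnNge; apply/negP => /(bm _).2 E; rewrite E in lti.
pose s j := if j == i then i.+1 else if j == i.+1 then i else j.
have sK : involutive s.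
  move=> j; rewrite /s; case: (j =P i) => [->|ji].
    by rewrite eqn_leq ltnn /= eqxx.
  case: (j =P i.+1) => [->|ji']; first by rewrite eqxx.
  by case: eqP => // _; case: eqP.
pose m' := mperm s s m.
have m'E j : m' j = m (s j) by rewrite mpermE.
have si : s i = i.+1 by rewrite /s eqxx.
have sj j : (j < i)%N -> s j = j by move=> lt; rewrite /s !ltn_eqF // leqW.
have E : f m = f m'.
  by apply: (fs s) => [|j]; [exists s | rewrite m'E sK].
case/eqP: fm0; rewrite E; apply: top => [j|].
  rewrite m'E; split; first by case: (bm (s j)).
  move=> leNj; rewrite /s !gtn_eqF; first exact: (bm j).2.
    exact: leq_trans leNj.
  by apply: leq_trans leNj; exact: ltnW.
by exists i => [j ji|]; rewrite m'E; [rewrite sj | rewrite si].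
Qed.

(** Lexicographic descent, run as an induction on a strict upper bound for the codes of the bounded
    monomials that occur in [a]; the degree bound [N] stays fixed. *)
Lemma symmetric_generated (a : QSym) : symmetric_series (qsfun a) ->
  subalgebra_generated (fun u : QSym => exists k, u = elementary k) a.
Proof.
have /qsymmetricP[_ [N]] := qsfunP a; rewrite -/(degree_le _ N).
move=> aN asym.
have : forall m, bounded_mon N m -> (N.+1 ^ N <= code N.+1 N m)%N -> qsfun a m = 0.
  move=> m bm; rewrite leqNgt code_bound // => j.
  by rewrite ltnS; case: (bm j).
(* At bound [0] all bounded monomials have coefficient zero, and by quasisymmetry these determine
   [a] in degrees up to [N]. *)
elim: (N.+1 ^ N)%N a aN asym => [|k IH] a aN asym a0.
  suff -> : a = 0 by exact: subalgebra_0.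
  apply: val_inj; apply/funext => m /=; case: (ltnP N (mdeg m)) => [/aN //|leN].
  by rewrite -(qsym_compmon m (qsfunP a)) a0 //; exact: bounded_compmon.
(* If no monomial of code [k] occurs, the bound drops at once; otherwise that monomial is the
   leading one and has to be cancelled. *)
have [[m [bm codem am0]]|nex] := pselect (exists m, [/\ bounded_mon N m,
  code N.+1 N m = k & qsfun a m != 0]); last first.
  apply: IH => // m bm; rewrite leq_eqVlt => /predU1P[codem|]; last exact: a0.
  by apply/eqP; apply: contraT => am0; case: nex; exists m.
have top m' : bounded_mon N m' -> lexlt m m' -> qsfun a m' = 0.
  by move=> bm' lt; apply: a0 => //; rewrite -codem; exact: bounded_lexlt.
have m_decr := symmetric_decreasing asym bm am0 top.
have [w wm] := eprod_lm_surj m_decr (fun i => (bm i).2).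
have [w1 w0] := lead_eprod w; rewrite wm in w1 w0.
pose c := qsfun a m; pose b := a - eprod w *~ c.
have bE m' : qsfun b m' = qsfun a m' - qsfun (eprod w) m' *~ c.
  rewrite qsfunB; congr (_ - _).
  exact: (morphB_mulz (f := fun u => qsfun u m')).
have degm : (mdeg m <= N)%N by rewrite leqNgt; apply: contra am0 => /aN ->.
have -> : a = b + eprod w *~ c by rewrite subrK.
apply: subalgebra_D; last first.
  apply: subalgebra_mulz; apply: subalgebra_prod => j.
  by apply: subalgebra_gen; exists j.+1.
apply: IH => [m' lt|s sbij m' m'' E|m' bm' lek].
- rewrite bE aN // degree_eprod ?mul0rz ?subr0 // wm.
  exact: leq_ltn_trans degm lt.
- by rewrite !bE (asym s sbij _ _ E) (symmetric_eprod w sbij E).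
(* At [m] the coefficients cancel, above [m] both vanish, and a smaller bounded monomial would have
   code below [k]. *)
- rewrite bE; case: (lexlt_total m m') => [<-|lt|lt].
  + by rewrite w1 intz subrr.
  + by rewrite top // w0 // mul0rz subr0.
  + by have := bounded_lexlt bm' bm lt; rewrite codem ltnNge lek.
Qed.

(** * The presentation *)

Lemma sharp1_word (t : seq nat) : sharp 1 << FMonom t >> = \prod_(k <- t) qh k.+1.
Proof.
elim: t => [|k t IH].
  rewrite big_nil (_ : FMonom [::] = mone) //.
  by apply: val_inj; rewrite /= fm1.
rewrite big_cons -IH /= /nh /= -sharp1M malgMUU mul1r; congr (sharp 1 << _ >>).
by apply: val_inj; rewrite /= fmM.
Qed.

Lemma sharp_eprod (s : seq nat) : sharp (eprod s) 1 = \prod_(k <- s) qe k.+1.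
Proof.
rewrite /eprod; elim: s => [|k s IH]; first by rewrite !big_nil.
by rewrite !big_cons -IH /= sharpM1.
Qed.

Lemma qproj_generated u : qproj u <->
  subalgebra_generated (fun v : heis => exists n : nat, v = qe n \/ v = qh n) u.
Proof.
split; apply: (subalgebra_morph (f := id)) => // {u} u.
  case=> [[x ->]|[a [asym ->]]].
    apply: subalgebra_sum => al.
    have -> : << 1 *~ x@_al *g al >> = sharp 1 << al >> *~ x@_al :> heis.
      rewrite /sharp -tensorU -(morphB_mulz _ _ (tensorBr (1 : QSym))).
      by rewrite -[in LHS](intz x@_al) (raddfMz (mkmalgU al)).
    apply: subalgebra_mulz.
    have -> : al = FMonom al by apply: val_inj.
    rewrite sharp1_word; apply: subalgebra_prod => k.
    by apply: subalgebra_gen; exists k.+1; right.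
  (* The map from [a] to [sharp a 1] is a ring morphism, so generation of the symmetric functions
     carries over. *)
  move/symmetric_generated: asym.
  apply: (subalgebra_morph (f := fun a => sharp a 1)) => // [b c|b c|b [k ->]].
  - exact: tensorBl.
  - exact: sharpM1.
  by apply: subalgebra_gen; exists k; left.
case=> n [->|->]; apply: subalgebra_gen; [right|left].
  by exists (elementary n); split=> //; exact: symmetric_elementary.
by exists (nh n).
Qed.

(** * Congruence modulo a two-sided ideal *)

Section IdealCongruence.
Variables (R : nzRingType) (S : R -> Prop).
Implicit Types x y z : R.

Definition ideal_cong x y : Prop := ideal_generated S (x - y).

Lemma ideal_congR x : ideal_cong x x.
Proof. by rewrite /ideal_cong subrr; exact: ideal_0. Qed.

Lemma ideal_cong_sym x y : ideal_cong x y -> ideal_cong y x.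
Proof. by move=> xy; have := ideal_B (@ideal_0 R S) xy; rewrite sub0r opprB. Qed.

Lemma ideal_congB x x' y y' :
  ideal_cong x x' -> ideal_cong y y' -> ideal_cong (x - y) (x' - y').
Proof.
move=> xx' yy'; have := ideal_B xx' yy'.
by rewrite /ideal_cong !opprD !opprK addrACA.
Qed.

Lemma ideal_cong_trans y x z : ideal_cong x y -> ideal_cong y z -> ideal_cong x z.
Proof.
move=> xy /ideal_cong_sym zy; have := ideal_B xy zy.
by rewrite /ideal_cong opprB addrA subrK.
Qed.

Lemma ideal_congMl z x y : ideal_cong x y -> ideal_cong (z * x) (z * y).
Proof. by move=> xy; rewrite /ideal_cong -mulrBr; exact: ideal_Ml. Qed.

Lemma ideal_congMr z x y : ideal_cong x y -> ideal_cong (x * z) (y * z).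
Proof. by move=> xy; rewrite /ideal_cong -mulrBl; exact: ideal_Mr. Qed.

Lemma ideal_cong_swap x y z : ideal_cong (x * y) (y * x) ->
  ideal_cong (x * (y * z)) (y * (x * z)).
Proof. by move=> /(ideal_congMr z); rewrite !mulrA. Qed.

(** Reads a commutator relation as a rule that moves [h] to the right past [e], in front of any
    [z]. *)
Lemma ideal_cong_commutator h e e' h' z :
  ideal_cong (commutator h e) (e' * h') ->
  ideal_cong (h * (e * z)) (e * (h * z) + e' * (h' * z)).
Proof.
move=> /(ideal_congMr z); rewrite /ideal_cong /commutator.
by rewrite mulrBl !mulrA opprD addrA.
Qed.
End IdealCongruence.

(** * Normal words and their independence *)

Definition e_part : seq (nat + nat) -> seq nat :=
  pmap (fun x => if x is inl k then Some k else None).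
Definition h_part : seq (nat + nat) -> seq nat :=
  pmap (fun x => if x is inr k then Some k else None).

Definition normal_word (s t : seq nat) : {fmonom (nat + nat)%type} :=
  FMonom (map inl s ++ map inr t).

(** Only the [inl] letters are sorted: the letters [inr] satisfy no relation among themselves. *)
Definition normal (w : {fmonom (nat + nat)%type}) : bool :=
  (w == normal_word (e_part w) (h_part w)) && sorted leq (e_part w).

Lemma e_part_normal s t : e_part (normal_word s t) = s.
Proof.
rewrite /e_part pmap_cat -[RHS]cats0; congr (_ ++ _); last by elim: t.
by elim: s => //= k s ->.
Qed.

Lemma h_part_normal s t : h_part (normal_word s t) = t.
Proof.
rewrite /h_part pmap_cat -[RHS]cat0s; congr (_ ++ _); first by elim: s.
by elim: t => //= k t ->.
Qed.

Lemma normal_normal_word s t : normal (normal_word s t) = sorted leq s.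
Proof. by rewrite /normal e_part_normal h_part_normal eqxx. Qed.

Lemma presentation_map_normal w c : normal w ->
  presentation_map << c *g w >> =
    << eprod (e_part w) *g FMonom (h_part w) >> *~ c :> heis.
Proof.
case/andP=> /eqP wE _; rewrite {1}wE /presentation_map free_evalU; congr (_ *~ c).
rewrite big_cat !big_map /= -sharp_word [RHS]sharpE.
by rewrite sharp_eprod sharp1_word.
Qed.

Lemma lex_max (T : eqType) (f : T -> mon) (s : seq T) (x0 : T) : x0 \in s ->
  exists2 x, x \in s & forall y, y \in s -> ~ lexlt (f x) (f y).
Proof.
elim: s x0 => // x s IH x0 _; case: s IH => [|x1 s] IH.
  by exists x; rewrite ?mem_head // => y /[!inE]/eqP ->; exact: lexltnn.
have [z zs zmax] := IH x1 (mem_head _ _).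
have [lt|nlt] := pselect (lexlt (f z) (f x)).
  exists x; rewrite ?mem_head // => y; rewrite inE => /predU1P[->|ys lt'].
    exact: lexltnn.
  exact: zmax ys (lexlt_trans lt lt').
exists z; first by rewrite inE zs orbT.
by move=> y; rewrite inE => /predU1P[->|/zmax].
Qed.

(** Take a word [w] of the support whose $e_s$ has a maximal leading monomial [m]. The coefficient
    of the image at [m], in the component of the $\mathbf{h}$-word of [w], comes from [w] alone. *)
Lemma normal_independent (q : free_alg) : {in msupp q, forall w, normal w} ->
  presentation_map q = 0 -> q = 0.
Proof.
move=> qn q0; apply/eqP; rewrite -msupp_eq0; apply: contraT => /fset0Pn[w1 w1q].
have [w wq wmax] := lex_max (fun w : {fmonom (nat + nat)%type} => eprod_lm (e_part w)) w1q.
pose m := eprod_lm (e_part w).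
pose coef (u : heis) : int := qsfun u@_(FMonom (h_part w)) m.
have coefB u v : coef (u - v) = coef u - coef v by rewrite /coef mcoeffB qsfunB.
have coef0 : coef 0 = 0 by have := coefB 0 0; rewrite !subrr.
have coefD u v : coef (u + v) = coef u + coef v.
  by have := coefB (u + v) v; rewrite addrK => ->; rewrite subrK.
have : coef (presentation_map q) = 0 by rewrite q0.
rewrite {1}[q]monalgE /presentation_map raddf_sum /= -/presentation_map.
rewrite (big_morph coef coefD coef0) (big_fsetD1 w) //= big1_fset => [|v].
  rewrite presentation_map_normal ?qn // (morphB_mulz _ _ coefB).
  rewrite /coef mcoeffUU (lead_eprod (e_part w)).1 intz addr0 => /eqP.
  by rewrite mcoeff_eq0 wq.
rewrite in_fsetD1 => /andP[/eqP nvw vq] _.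
rewrite presentation_map_normal ?qn // (morphB_mulz _ _ coefB) /coef mcoeffU.
case: eqP => [/(congr1 (@fmonom_val nat)) /= hE|_]; last by rewrite mul0rz.
have [eE|lt|lt] := lexlt_total (eprod_lm (e_part v)) m.
- case: nvw; have [/andP[/eqP vE sv] /andP[/eqP wE sw]] := (qn v vq, qn w wq).
  rewrite vE wE hE; congr normal_word.
  exact: (sorted_eq leq_trans anti_leq) sv sw (eprod_lm_inj eE).
- by rewrite (lead_eprod (e_part v)).2 // mul0rz.
- by case: (wmax v vq).
Qed.

(** * Reduction to normal words *)

Local Notation "x == y %[ideal]" := (ideal_cong relator x y)
  (at level 70, y at next level, format "x  ==  y  %[ideal]").

Definition wd (w : seq (nat + nat)) : free_alg := << FMonom w >>.

Lemma wd_cat v w : wd (v ++ w) = wd v * wd w.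
Proof.
by rewrite /wd malgMUU mul1r; congr << _ >>; apply: val_inj; rewrite /= fmM.
Qed.

Lemma wd_cons x w : wd (x :: w) = wd [:: x] * wd w.
Proof. by rewrite -wd_cat. Qed.

Lemma wd_e_swap j k w :
  wd [:: inl j, inl k & w] == wd [:: inl k, inl j & w] %[ideal].
Proof.
rewrite !(wd_cons _ (_ :: w)) !(wd_cons _ w).
apply: ideal_cong_swap; apply: ideal_gen; exact: (relator_ee j.+1 k.+1).
Qed.

Lemma wd_e_insert s k s' :
  wd (map inl (s ++ k :: s')) == wd (map inl (k :: s ++ s')) %[ideal].
Proof.
elim: s => [|j s IH]; first exact: ideal_congR.
rewrite [map _ _]/= wd_cons; apply: ideal_cong_trans (ideal_congMl _ IH) _.
rewrite -wd_cons; exact: wd_e_swap.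
Qed.

Lemma wd_e_perm s s' : perm_eq s s' ->
  wd (map inl s) == wd (map inl s') %[ideal].
Proof.
elim: s s' => [|k s IH] s'.
  by rewrite perm_sym => /perm_nilP->; exact: ideal_congR.
move=> ss'; have := perm_mem ss' k; rewrite mem_head => /esym ks'.
case/splitPr: ks' ss' => s1 s2.
rewrite perm_sym perm_catC /= perm_cons perm_catC perm_sym => /IH {}IH.
apply: ideal_cong_trans (ideal_cong_sym (wd_e_insert _ _ _)).
by rewrite wd_cons [X in _ == X %[ideal]]wd_cons; exact: ideal_congMl.
Qed.

Definition reducible (p : free_alg) : Prop :=
  exists2 q : free_alg, p == q %[ideal] & {in msupp q, forall w, normal w}.

Lemma reducible_cong p p' : p == p' %[ideal] -> reducible p' -> reducible p.
Proof. by move=> pp' [q p'q qn]; exists q => //; exact: ideal_cong_trans pp' p'q. Qed.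

Lemma reducibleB p q : reducible p -> reducible q -> reducible (p - q).
Proof.
move=> [p' pp' p'n] [q' qq' q'n]; exists (p' - q'); first exact: ideal_congB.
move=> w /(fsubsetP (msuppB_le _ _)); rewrite in_fsetU.
by case/orP => [/p'n|/q'n].
Qed.

Lemma reducible0 : reducible 0.
Proof. by exists 0 => [|w]; [exact: ideal_congR | rewrite msupp0 in_fset0]. Qed.

Lemma reducibleD p q : reducible p -> reducible q -> reducible (p + q).
Proof.
move=> rp rq; rewrite -(opprK q) -(sub0r q); apply: reducibleB => //.
by apply: reducibleB => //; exact: reducible0.
Qed.

Lemma reducible_mulz p c : reducible p -> reducible (p *~ c).
Proof.
move=> rp; have rn n : reducible (p *+ n).
  elim: n => [|n IH]; first by rewrite mulr0n; exact: reducible0.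
  by rewrite mulrS; apply: reducibleD.
case: c => n; first by rewrite -pmulrn; exact: rn.
by rewrite NegzE mulrNz -pmulrn -sub0r; apply: reducibleB; [exact: reducible0|exact: rn].
Qed.

Lemma reducible_linear (f : free_alg -> free_alg) (p : free_alg) :
  (forall x y, f (x - y) = f x - f y) ->
  (forall w, w \in msupp p -> reducible (f (wd w))) -> reducible (f p).
Proof.
move=> fB fw.
have f0 : f 0 = 0 by have := fB 0 0; rewrite !subrr.
have fD x y : f (x + y) = f x + f y.
  by have := fB (x + y) y; rewrite addrK => ->; rewrite subrK.
rewrite [p]monalgE (big_morph f fD f0) big_seq.
apply: (big_ind reducible); [exact: reducible0 | exact: reducibleD | move=> w wp].
have -> : << p@_w *g w >> = wd w *~ p@_w.
  have wE : FMonom w = w by apply: val_inj.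
  by rewrite /wd wE -[in LHS](intz p@_w); exact: (raddfMz (mkmalgU w)).
by rewrite (morphB_mulz _ _ fB); apply: reducible_mulz; exact: fw.
Qed.

(** A reducible factor can be replaced by its normal form before multiplying, so [x] need only be
    tested on normal words. *)
Lemma reducible_Ml x p : (forall w, normal w -> reducible (x * wd w)) ->
  reducible p -> reducible (x * p).
Proof.
move=> xw [q pq qn]; apply: reducible_cong (ideal_congMl x pq) _.
apply: (reducible_linear (f := fun y => x * y)) => [y z|w /qn /xw //].
exact: malgMBr.
Qed.

Lemma reducible_eh s t : reducible (wd (normal_word s t)).
Proof.
apply: (@reducible_cong _ (wd (normal_word (sort leq s) t))).
  rewrite !wd_cat; apply: ideal_congMr; apply: wd_e_perm.
  by rewrite perm_sym perm_sort.
exists (wd (normal_word (sort leq s) t)); first exact: ideal_congR.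
move=> w; rewrite /wd => /(fsubsetP msuppU_le).
rewrite in_fset1 => /eqP ->; rewrite normal_normal_word.
exact: sort_sorted leq_total _.
Qed.

Lemma normalE w : normal w -> exists s t, w = normal_word s t.
Proof. by case/andP=> /eqP -> _; exists (e_part w), (h_part w). Qed.

Lemma reducible_e (k : nat) p : reducible p -> reducible (free_e k * p).
Proof.
case: k => [|k]; first by rewrite mul1r.
apply: reducible_Ml => _ /normalE[s [t ->]].
rewrite -[free_e _]/(wd [:: inl k]) -wd_cat; exact: (reducible_eh (k :: s)).
Qed.

(** Moving [free_h n] past the first $E$ letter leaves two terms, in each of which an $H$ faces the
    shorter [s]. One of them lowers [n], so the induction on [s] keeps [n] general. *)
Lemma reducible_h_normal (n : nat) s t : reducible (free_h n * wd (normal_word s t)).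
Proof.
elim: s n => [|k s IH] [|n]; rewrite ?mul1r; try exact: reducible_eh.
  rewrite -[free_h _]/(wd [:: inr n]) -wd_cat; exact: (reducible_eh [::] (n :: t)).
rewrite [normal_word _ _ : seq _]/= wd_cons -[wd [:: _]]/(free_e k.+1).
apply: reducible_cong.
  apply: ideal_cong_commutator; apply: ideal_gen; exact: (relator_he n.+1 k.+1).
by rewrite !PoszS_sub1; apply: reducibleD; apply: reducible_e; exact: IH.
Qed.

Lemma reducible_wd w : reducible (wd w).
Proof.
elim: w => [|[k|k] w IH]; first exact: (reducible_eh [::] [::]).
  by rewrite wd_cons; exact: (reducible_e k.+1).
rewrite wd_cons; apply: reducible_Ml IH => _ /normalE[s [t ->]].
exact: (reducible_h_normal k.+1).
Qed.

Lemma reducible_all p : reducible p.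
Proof. by apply: (reducible_linear (f := id)) => // w _; exact: reducible_wd. Qed.

(** * The kernel of the presentation map *)

Lemma presentation_mapB p q :
  presentation_map (p - q) = presentation_map p - presentation_map q.
Proof. exact: free_evalB. Qed.

Lemma presentation_mapM p q :
  presentation_map (p * q) = presentation_map p * presentation_map q.
Proof. exact: free_evalM. Qed.

Lemma presentation_map_commutator p q : presentation_map (commutator p q) =
  commutator (presentation_map p) (presentation_map q).
Proof.
by rewrite [LHS]presentation_mapB; congr (_ - _); exact: presentation_mapM.
Qed.

Lemma presentation_map_relator p : relator p -> presentation_map p = 0.
Proof.
case=> n k.
  rewrite [LHS]presentation_map_commutator !presentation_map_e.
  exact: qe_commutator.
rewrite [LHS]presentation_mapB; apply/eqP; rewrite subr_eq0; apply/eqP.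
rewrite [LHS]presentation_map_commutator [RHS]presentation_mapM.
apply: etrans (congr2 (@commutator heis) (presentation_map_h n) (presentation_map_e k)) _.
apply: etrans (qh_qe_commutator n k) (esym _).
by congr (_ * _); [exact: presentation_map_e | exact: presentation_map_h].
Qed.

Lemma presentation_map_ideal p : ideal_generated relator p -> presentation_map p = 0.
Proof.
elim=> {p} [p /presentation_map_relator //||p q _ p0 _ q0|p q _ q0|p q _ p0].
- exact: raddf0.
- by rewrite [LHS]presentation_mapB p0 q0 subrr.
- by rewrite [LHS]presentation_mapM q0 mulr0.
- by rewrite [LHS]presentation_mapM p0 mul0r.
Qed.

(** The normal form [q] of [p] is also sent to zero, because the ideal is; independence then gives
    [q = 0], which places [p] in the ideal. *)
Lemma presentation_map_kernel p : presentation_map p = 0 -> ideal_generated relator p.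
Proof.
move=> p0; have [q pq qn] := reducible_all p.
suff q0 : q = 0 by rewrite -(subr0 p) -q0.
apply: normal_independent qn _.
have := presentation_map_ideal pq.
rewrite presentation_mapB p0 sub0r => /eqP.
by rewrite oppr_eq0 => /eqP.
Qed.

Theorem proposition8p7 :
  [/\ forall u : heis,
        qproj u <->
        subalgebra_generated (fun v : heis => exists n : nat, v = qe n \/ v = qh n) u,
      forall n k : nat, commutator (qe n) (qe k) = 0,
      forall n k : nat,
        commutator (qh n) (qe k) = qe (k%:Z - 1) * qh (n%:Z - 1)
    & forall p : free_alg, presentation_map p = 0 <-> ideal_generated relator p].
Proof.
split; [exact: qproj_generated | exact: qe_commutator | exact: qh_qe_commutator |].
by move=> p; split; [exact: presentation_map_kernel | exact: presentation_map_ideal].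
Qed.
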